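(* Let $M\ge 1$ be an integer, $\alpha,\beta,\omega,A_0,h_l,\mathcal R_t>0$ and $c=\frac{e}{2\pi}$. For each $\bar\gamma>0$, let $\gamma_1,\dots,\gamma_M$ be independent, each with density $$f_{\gamma}(x)=\frac{\sqrt{\omega}}{2x\,\Gamma(\alpha)\Gamma(\beta)}\,G^{3,0}_{1,3}\!\left(\frac{\alpha\beta}{A_0h_l}\sqrt{\frac{x}{\bar\gamma}}\,\middle|\,\begin{matrix}\omega+\tfrac12\\ \alpha,\ \beta,\ \omega\end{matrix}\right),\qquad x>0,$$ and let $P^{\mathrm{ir}}_{o,M}=\mathbb P\!\left(\sum_{m=1}^M\log_2(1+c\gamma_m)<2\mathcal R_t\right)$ be the outage probability of HARQ with incremental redundancy after $M$ rounds. Then the diversity order is $$\mathcal D^{\infty}_{\mathrm{ir}}:=-\lim_{\bar\gamma\to\infty}\frac{\ln P^{\mathrm{ir}}_{o,M}}{\ln\bar\gamma}=\frac M2\min(\alpha,\beta,\omega).$$ In particular it is determined by the turbulence parameters (equal to $\frac M2\min(\alpha,\beta)$) when $\min(\alpha,\beta)<\omega$, and by the pointing-error parameter (equal to $\frac M2\omega$) when $\omega<\min(\alpha,\beta)$.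
   Context: Meijer $G$: $G^{3,0}_{1,3}\!\left(x\,\middle|\,\begin{matrix}a\\ b_1,b_2,b_3\end{matrix}\right)=\frac1{2\pi i}\int_L\frac{\Gamma(b_1-s)\Gamma(b_2-s)\Gamma(b_3-s)}{\Gamma(a-s)}x^s\,ds$ with $L$ an upward vertical line to the left of all poles of the numerator. The function $f_\gamma$ is an approximate density used as if exact (it is nonnegative but need not integrate exactly to $1$); accordingly, $\mathbb P((\gamma_1,\dots,\gamma_M)\in B)$ denotes $\int_B\prod_{m=1}^M f_\gamma(x_m)\,dx_1\cdots dx_M$ for Borel $B\subseteq(0,\infty)^M$. All parameters other than $\bar\gamma$ are held fixed in the limit. *)

(* Defs.v *)
From mathcomp Require Import all_boot all_order all_algebra.
From mathcomp Require Import complex.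
From mathcomp Require Import all_classical all_reals all_analysis.

Set Implicit Arguments.
Unset Strict Implicit.
Unset Printing Implicit Defensive.

Import Order.TTheory GRing.Theory Num.Theory.
Import numFieldNormedType.Exports.

Local Open Scope classical_set_scope.
Local Open Scope ring_scope.
Local Open Scope complex_scope.

Definition cexp {R : realType} (z : R[i]) : R[i] :=
  (expR (complex.Re z) * cos (complex.Im z))
    +i* (expR (complex.Re z) * sin (complex.Im z)).

(* Meaningful for x > 0 only. *)
Definition cpow {R : realType} (x : R) (s : R[i]) : R[i] :=
  cexp (s * (ln x)%:C).

Definition cintegral {R : realType} (D : set R) (F : R -> R[i]) : R[i] :=
  (\int[lebesgue_measure]_(t in D) complex.Re (F t))
    +i* (\int[lebesgue_measure]_(t in D) complex.Im (F t)).

(* Euler's integral; converges for Re z > 0. *)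
Definition euler_gamma {R : realType} (z : R[i]) : R[i] :=
  cintegral `]0, +oo[ (fun t => cpow t (z - 1) * (expR (- t))%:C).

(* The meromorphic Gamma function: n is the least natural number such that
   Re z + n > 0 (so n = 0 when Re z > 0), and
   Gamma(z) = Gamma(z + n) / (z (z + 1) ... (z + n - 1)).
   At the poles 0, -1, -2, ... the value is 0 since 0^-1 = 0, so that
   (Gamma z)^-1 agrees everywhere with the entire function 1 / Gamma. *)
Definition Gamma {R : realType} (z : R[i]) : R[i] :=
  let n := Num.truncn (1 - complex.Re z) in
  euler_gamma (z + n%:R) / \prod_(k < n) (z + k%:R).

(* G^{3,0}_{1,3}(x | a ; b1, b2, b3) for x > 0, with the contour L taken to be
   the upward line s = sigma + i t.  The poles of the numerator are the b_j + k,
   k natural, so L lies to the left of them iff sigma < min(b1, b2, b3). *)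
Definition meijerG3013 {R : realType} (sigma a b1 b2 b3 x : R) : R[i] :=
  ((2 * pi)%:C * 'i%C)^-1 *
  cintegral setT (fun t : R =>
    let s := sigma +i* t in
    Gamma (b1%:C - s) * Gamma (b2%:C - s) * Gamma (b3%:C - s)
      / Gamma (a%:C - s) * cpow x s * 'i%C).

(* The right-hand side is a real number, as t |-> - t conjugates the integrand
   of the Meijer function and real parameters have real Gamma values; Re only
   turns it into an element of R. *)
Definition snr_density {R : realType}
    (sigma alpha beta omega A0 hl gbar x : R) : R :=
  complex.Re ((Num.sqrt omega)%:C
    / ((2 * x)%:C * Gamma alpha%:C * Gamma beta%:C)
    * meijerG3013 sigma (omega + 2^-1) alpha beta omega
        (alpha * beta / (A0 * hl) * Num.sqrt (x / gbar))).

(* Integration over R^n with respect to n-dimensional Lebesgue measure, as an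
   iterated integral (Tonelli); meant for nonnegative measurable integrands. *)
Fixpoint tuple_integral {R : realType} (n : nat) :
    (n.-tuple R -> \bar R) -> \bar R :=
  match n with
  | 0 => fun F => F [tuple]
  | n'.+1 => fun F =>
      (\int[lebesgue_measure]_x
         tuple_integral (fun v : n'.-tuple R => F [tuple of x :: v]))%E
  end.

(* The integral over B of f(x_1) ... f(x_n) dx_1 ... dx_n; f is not required
   to integrate to 1. *)
Definition iid_prob {R : realType} (f : R -> R) (n : nat)
    (B : set (n.-tuple R)) : \bar R :=
  tuple_integral (fun x => (\1_B x * \prod_(m < n) f (tnth x m))%:E).

Definition log2 {R : realType} (x : R) : R := ln x / ln 2.

Definition outage_event {R : realType} (M : nat) (Rt : R) :
    set (M.-tuple R) :=
  let c := expR 1 / (2 * pi) in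
  [set x | (forall m : 'I_M, 0 < tnth x m) /\
           \sum_(m < M) log2 (1 + c * tnth x m) < 2 * Rt].

Definition outage_prob {R : realType} (M : nat)
    (sigma alpha beta omega A0 hl Rt gbar : R) : \bar R :=
  iid_prob (snr_density sigma alpha beta omega A0 hl gbar)
    (@outage_event R M Rt).

(* Main.v *)
From HB Require Import structures.
Require Import Defs.
From mathcomp Require Import all_boot all_order all_algebra.
From mathcomp Require Import complex.
From mathcomp Require Import all_classical all_reals all_analysis.
From mathcomp Require Import measurable_realfun ring lra.

(* With h_a(w) = exp (a w - e^w), Gamma (a + i t) is the Fourier transform of
   h_a, and Gamma (z) / Gamma (z + 1/2) is a Mellin transform of a positive
   kernel (Euler's Beta integral).  Fourier inversion applied to the factor
   Gamma (alpha - s) therefore turns the contour integral of the Meijer function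
   into the integral over the plane of a product of positive kernels, whatever
   the abscissa sigma < min (alpha, beta, omega).  Write m for this minimum.
   Pointwise bounds of the kernels give, as y -> 0,
     c y^m <= G(y) <= C_q y^q   for every q < m.
   The outage event contains a cube [k/2, k]^M and lies in a cube ]0, K[^M, so
   the outage probability lies between constant multiples of gbar^(- M m / 2)
   and gbar^(- M q / 2), and q is arbitrarily close to m. *)

Import Order.TTheory GRing.Theory Num.Theory.
Import numFieldNormedType.Exports.

Local Open Scope classical_set_scope.
Local Open Scope ring_scope.

Set Implicit Arguments.
Unset Strict Implicit.

(** * Real-valued Lebesgue integrals *)

(** Residues would give the exponents, but coinciding parameters create multiple poles, hence powers
    of ln y, and moving the contour calls for complex analysis. Positivity avoids both: for an
    integral of positive kernels a change of abscissa is an exponential tilt of the kernels, and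
    one-sided bounds suffice. The logarithms are also why the upper bound stops at q < m; a quotient
    of logarithms does not see this loss.

    Complex quantities are split into real and imaginary parts, and u = e^w turns Mellin transforms
    into Fourier transforms on the line. Exchanging the integrals requires absolute convergence: two
    uses of Gamma(z + 1) = z Gamma(z) give decay 1 / (1 + t^2) on vertical lines, in place of
    Stirling's formula, and only the factor Gamma(alpha - s) has to supply it. Dividing by
    Gamma(omega + 1/2 - s) requires that Gamma has no zero with positive real part; this comes from
    the concentration of the measure u^(x-1) e^(-u) du for large x, carried back by the functional
    equation. *)

Notation rintegrable mu f := (integrable mu setT (EFin \o f)).

Section Rintegrable.
Context d (T : measurableType d) (R : realType) (mu : {measure set T -> \bar R}).
Implicit Types f g : T -> R.

Lemma rintegrable_le f g : measurable_fun setT f ->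
  (forall x, `|f x| <= g x) -> rintegrable mu g -> rintegrable mu f.
Proof.
move=> mf fg; apply: le_integrable => //; first exact/measurable_EFinP.
by move=> x _; rewrite lee_fin (le_trans (fg x))// ler_norm.
Qed.

Lemma rintegrable_measurable f : rintegrable mu f -> measurable_fun setT f.
Proof. by move=> /integrableP[/measurable_EFinP]. Qed.

Lemma rintegrableZl (k : R) f : rintegrable mu f -> rintegrable mu (fun x => k * f x).
Proof.
move=> /(integrableZl measurableT k); apply: eq_integrable => //.
Qed.

Lemma rintegrableD f g : rintegrable mu f -> rintegrable mu g ->
  rintegrable mu (fun x => f x + g x).
Proof. by move=> /integrableD h /h{h}; apply. Qed.

Lemma rintegrableB f g : rintegrable mu f -> rintegrable mu g ->
  rintegrable mu (fun x => f x - g x).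
Proof. by move=> /integrableB h /h{h}; apply. Qed.

Lemma rintegrable_norm f : rintegrable mu f -> rintegrable mu (fun x => `|f x|).
Proof. by move=> /integrable_norm. Qed.

Lemma EFin_Rintegral f : rintegrable mu f ->
  (\int[mu]_x f x)%:E = (\int[mu]_x (f x)%:E)%E.
Proof. by move=> fi; rewrite fineK//; exact: integrable_fin_num. Qed.

Lemma Rintegral_dominated_cvg (f_ : nat -> T -> R) f g :
  (forall n, measurable_fun setT (f_ n)) -> measurable_fun setT f ->
  (forall x, f_ n x @[n --> \oo] --> f x) ->
  rintegrable mu g -> (forall n x, `|f_ n x| <= g x) ->
  \int[mu]_x f_ n x @[n --> \oo] --> \int[mu]_x f x.
Proof.
move=> mf_ mf f_f ig f_g.
have fi n : rintegrable mu (f_ n) by apply: rintegrable_le ig.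
have /dominated_convergence : {ae mu, forall x, setT x ->
    (EFin \o f_ n) x @[n --> \oo] --> (EFin \o f) x}.
  by apply: aeW => x _; apply/fine_cvgP; split; [exact: nearW|exact: f_f].
move=> /(_ measurableT (EFin \o g)) [].
- by move=> n; exact/measurable_EFinP.
- exact/measurable_EFinP.
- exact: ig.
- by apply: aeW => x n _; exact: f_g.
by move=> fi' _ h; apply: fine_cvg; rewrite EFin_Rintegral.
Qed.
Lemma Rintegral_ge_on (A : set T) (f : T -> R) (c r : R) :
  d.-measurable A -> mu A = r%:E -> rintegrable mu f -> 0 <= c ->
  (forall x, 0 <= f x) -> (forall x, A x -> c <= f x) ->
  c * r <= \int[mu]_x f x.
Proof.
move=> mA mur fi c0 f0 cf; rewrite -lee_fin EFin_Rintegral// EFinM -mur.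
have mf : measurable_fun setT (EFin \o f).
  exact/measurable_EFinP/rintegrable_measurable.
rewrite -integral_cst//; apply: (@le_trans _ _ (\int[mu]_(x in A) (f x)%:E)%E).
  by apply: ge0_le_integral => //; exact: measurable_funS mf.
by apply: ge0_subset_integral => // x _; rewrite lee_fin.
Qed.
End Rintegrable.

(** * Fubini's theorem for real-valued integrals *)

Section RFubini.
Context d1 d2 (T1 : measurableType d1) (T2 : measurableType d2) (R : realType).
Context (m1 : {sigma_finite_measure set T1 -> \bar R})
        (m2 : {sigma_finite_measure set T2 -> \bar R}).
Implicit Type f : T1 * T2 -> R.

(** Every slice is assumed integrable, not just almost every one, so that the inner real integral
    coincides everywhere with the extended one to which Fubini's theorem applies. *)
Lemma Rintegral12_prod f : rintegrable (m1 \x m2)%E f ->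
  (forall x, rintegrable m2 (fun y => f (x, y))) ->
  \int[m1]_x \int[m2]_y f (x, y) = \int[(m1 \x m2)%E]_z f z.
Proof.
move=> fi fx; rewrite [RHS]/Rintegral.
rewrite -(integral12_prod_meas1 fi) /fubini_F; congr fine.
by apply: eq_integral => x _; rewrite EFin_Rintegral.
Qed.

Lemma Rintegral21_prod f : rintegrable (m1 \x m2)%E f ->
  (forall y, rintegrable m1 (fun x => f (x, y))) ->
  \int[m2]_y \int[m1]_x f (x, y) = \int[(m1 \x m2)%E]_z f z.
Proof.
move=> fi fx; rewrite [RHS]/Rintegral.
rewrite -(integral21_prod_meas1 fi) /fubini_G; congr fine.
by apply: eq_integral => x _; rewrite EFin_Rintegral.
Qed.

Lemma rintegrable_prod12 f : rintegrable (m1 \x m2)%E f ->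
  (forall x, rintegrable m2 (fun y => f (x, y))) ->
  rintegrable m1 (fun x => \int[m2]_y f (x, y)).
Proof.
move=> fi fx; apply: eq_integrable (integrable_fubini_F fi) => // x _.
by rewrite /= EFin_Rintegral.
Qed.

Lemma rintegrable_prodM (A : T1 -> R) (B : T2 -> R) :
  rintegrable m1 A -> rintegrable m2 B ->
  rintegrable (m1 \x m2)%E (fun z => A z.1 * B z.2).
Proof.
move=> Ai Bi.
have mA := rintegrable_measurable Ai; have mB := rintegrable_measurable Bi.
have mAB : measurable_fun setT (EFin \o (fun z : T1 * T2 => A z.1 * B z.2)).
  by apply/measurable_EFinP; apply: measurable_funM; exact: measurableT_comp.
apply/(integrable12ltyP _ _ mAB) => /=.
under eq_integral => x _.
  under eq_integral => y _ do rewrite normrM EFinM.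
  rewrite ge0_integralZl//; last first.
    by do 2 apply: measurableT_comp => //.
  rewrite -(EFin_Rintegral (rintegrable_norm Bi)) muleC.
  over.
rewrite ge0_integralZl//; last 2 first.
- by do 2 apply: measurableT_comp => //.
- by rewrite lee_fin Rintegral_ge0.
by rewrite -(EFin_Rintegral (rintegrable_norm Ai)) -EFinM ltry.
Qed.

Lemma rintegrable_prod_le f (A : T1 -> R) (B : T2 -> R) :
  measurable_fun setT f -> (forall x y, `|f (x, y)| <= A x * B y) ->
  rintegrable m1 A -> rintegrable m2 B -> rintegrable (m1 \x m2)%E f.
Proof.
move=> mf fAB Ai Bi; apply: (rintegrable_le mf _ (rintegrable_prodM Ai Bi)).
by move=> [x y]; exact: fAB.
Qed.

Lemma Rintegral_prodM (A : T1 -> R) (B : T2 -> R) :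
  rintegrable m1 A -> rintegrable m2 B ->
  \int[(m1 \x m2)%E]_z (A z.1 * B z.2) = \int[m1]_x A x * \int[m2]_y B y.
Proof.
move=> Ai Bi.
have ABi x : rintegrable m2 (fun y => A x * B y) by exact: rintegrableZl.
rewrite -(Rintegral12_prod (rintegrable_prodM Ai Bi))//=.
under eq_Rintegral do rewrite RintegralZl//.
by rewrite RintegralZr.
Qed.
End RFubini.

Section ProductSigmaFinite.
Local Open Scope ereal_scope.
Context d1 d2 (T1 : measurableType d1) (T2 : measurableType d2) (R : realType).
Context (m1 : {sigma_finite_measure set T1 -> \bar R})
        (m2 : {sigma_finite_measure set T2 -> \bar R}).

(** Products of two increasing covers by sets of finite measure cover the product. This allows
    Fubini between the contour variable and the plane of the two other kernels. *)
Lemma product_measure_sigma_finite : sigma_finite setT (m1 \x m2).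
Proof.
have /sigma_finiteP[F [TF ndF Foo]] := sigma_finiteT m1.
have /sigma_finiteP[G [TG ndG Goo]] := sigma_finiteT m2.
exists (fun n => F n `*` G n); last first.
  move=> k; have [mF Fk] := Foo k; have [mG Gk] := Goo k.
  split; first exact: measurableX.
  by rewrite product_measure1E// lte_mul_pinfty// ge0_fin_numE.
rewrite -setXTT TF TG; apply/seteqP; split=> -[x y].
  move=> [/= [n _ Fnx] [k _ Gky]]; exists (maxn n k) => //; split.
    by move: x Fnx; exact/subsetPset/ndF/leq_maxl.
  by move: y Gky; exact/subsetPset/ndG/leq_maxr.
by move=> [n _ []/= ? ?]; split; exists n.
Qed.

(* The canonical sigma-finite structure of a product is registered only for
   subprobability factors. *)
Definition sigma_finite_prod : {sigma_finite_measure set (T1 * T2)%type -> \bar R} :=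
  HB.pack (m1 \x m2)
    (Measure_isSigmaFinite.Build _ _ _ (m1 \x m2) product_measure_sigma_finite).

End ProductSigmaFinite.

(** * Fourier inversion on the real line *)

Section RealLine.
Context (R : realType).
Local Notation mu := (@lebesgue_measure R).

Lemma measurable_affine (l k : R) :
  measurable_fun setT ((fun y => l + k * y) : R -> measurableTypeR R).
Proof. by apply: measurable_funD => //; exact: measurable_funM. Qed.

(** By uniqueness of Lebesgue measure: k times its image under y |-> l + k y gives each interval ]a,
    b] its length. *)
Lemma ge0_integral_affine (f : R -> \bar R) (l k : R) : 0 < k ->
  measurable_fun setT f -> (forall x, (0 <= f x)%E) ->
  (k%:E * \int[mu]_y f (l + k * y)%R = \int[mu]_x f x)%E.
Proof.
move=> k0 mf f0.
pose phi : R -> measurableTypeR R := fun y => l + k * y.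
have mphi : measurable_fun setT phi := measurable_affine l k.
pose kn : {nonneg R} := NngNum (ltW k0).
have nuE A : measurable A -> mu A = mscale kn (pushforward mu phi) A.
  move=> mA; apply: lebesgue_measure_unique => // _ [[a b]] _ <-.
  rewrite /= /mscale /pushforward /=.
  rewrite [X in (_ * mu X)%E](_ : _ = `](a - l) / k, (b - l) / k]%classic); last first.
    by apply/seteqP; split=> x /=; rewrite /phi !in_itv/= ltr_pdivrMr//
      ler_pdivlMr// ltrBlDl lerBrDl ![x * k]mulrC.
  rewrite !lebesgue_measure_itv/= !lte_fin ltr_pM2r ?invr_gt0// ltrD2r.
  case: ifP => _; last by rewrite mule0.
  by rewrite -!EFinB -EFinM; congr EFin; field; rewrite gt_eqF.
rewrite [RHS](eq_measure_integral (mscale kn (pushforward mu phi))); last by move=> A mA _; exact: nuE.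
rewrite ge0_integral_mscale//; congr (_ * _)%E.
by rewrite ge0_integral_pushforward// => y _; exact: f0.
Qed.

Lemma rintegrable_affine (f : R -> R) (l k : R) : 0 < k ->
  rintegrable mu f -> rintegrable mu (fun y => f (l + k * y)).
Proof.
move=> k0 fi; have mf := rintegrable_measurable fi.
apply/integrableP; split.
  by apply/measurable_EFinP; apply: measurableT_comp => //; exact: measurable_affine.
have mnf : measurable_fun setT (fun x => (`|f x|)%:E).
  by apply/measurable_EFinP; exact: measurableT_comp.
move/integrableP : fi => [_ /=].
rewrite -(ge0_integral_affine l k0 mnf)//.
rewrite !ltey; apply: contra => /eqP ->.
by rewrite gt0_muley ?lte_fin.
Qed.

Lemma Rintegral_affine (f : R -> R) (l k : R) : 0 < k ->
  rintegrable mu f -> k * \int[mu]_y f (l + k * y) = \int[mu]_x f x.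
Proof.
move=> k0 fi; apply: EFin_inj.
rewrite EFinM !EFin_Rintegral//; last exact: rintegrable_affine.
have mf := rintegrable_measurable fi.
rewrite [in LHS]integralE [in RHS]integralE.
have fin_pos := integrable_pos_fin_num measurableT (rintegrable_affine l k0 fi).
have fin_neg := integrable_neg_fin_num measurableT (rintegrable_affine l k0 fi).
rewrite muleBr//; last exact: fin_num_adde_defr.
have mfE : measurable_fun setT (EFin \o f) by exact/measurable_EFinP.
congr (_ - _)%E.
  rewrite -[RHS](ge0_integral_affine l k0 (measurable_funepos mfE))//.
  by congr (_ * _)%E; apply: eq_integral => x _; rewrite !funeposE.
rewrite -[RHS](ge0_integral_affine l k0 (measurable_funeneg mfE))//.
by congr (_ * _)%E; apply: eq_integral => x _; rewrite !funenegE.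
Qed.

(* The truncations to [-n, n] reduce this to the fundamental theorem of
   calculus on a segment. *)
Lemma Rintegral_derive_eq0 (F f : R -> R) :
  (forall x : R, is_derive x 1 F (f x)) -> continuous f -> rintegrable mu f ->
  F x @[x --> +oo] --> (0 : R) -> F x @[x --> -oo] --> (0 : R) ->
  \int[mu]_x f x = 0.
Proof.
move=> dF cf fi Fy FNy.
have mf := rintegrable_measurable fi.
pose f_ n x := f x * \1_(`[- n.+1%:R, n.+1%:R] : set R) x.
have fE n : \int[mu]_x f_ n x = F n.+1%:R - F (- n.+1%:R).
  have -> : f_ n = f \_ `[- n.+1%:R, n.+1%:R].
    apply/funext => x; rewrite /f_ patchE indicE.
    by case: ifPn => _; rewrite ?mulr1 ?mulr0.
  rewrite -Rintegral_mkcond /Rintegral (@continuous_FTC2 _ f F)//.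
  - by rewrite (@lt_trans _ _ 0)// oppr_lt0.
  - exact: continuous_subspaceT.
  - have cF : continuous F.
      move=> x; apply/differentiable_continuous/derivable1_diffP.
      by case: (dF x).
    split => [x _||].
    + by case: (dF x).
    + exact/cvg_at_right_filter/cF.
    + exact/cvg_at_left_filter/cF.
  - by move=> x _; rewrite derive1E; case: (dF x).
have h1 : \int[mu]_x f_ n x @[n --> \oo] --> \int[mu]_x f x.
  apply: (Rintegral_dominated_cvg _ _ _ (rintegrable_norm fi)) => //.
  - move=> n; apply: measurable_funM => //.
  - move=> x; apply: cvg_near_cst.
    exists (Num.truncn `|x|) => // n /= xn.
    rewrite /f_ indicE mem_set ?mulr1//= in_itv/= -ler_norml.
    rewrite (le_trans (ltW (truncnS_gt _)))// ler_nat ltnS//.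
  - move=> n x; rewrite /f_ normrM ler_piMr// indicE.
    by case: (_ \in _); rewrite ?normr1 ?normr0.
have h2 : \int[mu]_x f_ n x @[n --> \oo] --> 0.
  under eq_fun do rewrite fE.
  have ny : (n.+1%:R : R) @[n --> \oo] --> +oo.
    apply/cvgryPge => A; near=> n.
    by rewrite (le_trans (ltW (truncnS_gt A)))// ler_nat ltnS; near: n; exact: nbhs_infty_ge.
  rewrite (_ : 0 = 0 - 0); last by rewrite subrr.
  apply: cvgB; first exact: (cvg_comp _ _ ny Fy).
  by move/cvgNy_compNP : FNy; exact: (cvg_comp _ _ ny).
exact: cvg_unique h1 h2.
Unshelve. all: by end_near. Qed.

Lemma continuous_mul (f g : R -> R) : continuous f -> continuous g ->
  continuous (fun x => f x * g x).
Proof. by move=> cf cg x; exact: (continuousM (cf x) (cg x)). Qed.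

Lemma continuous_add (f g : R -> R) : continuous f -> continuous g ->
  continuous (fun x => f x + g x).
Proof. by move=> cf cg x; exact: (continuousD (cf x) (cg x)). Qed.

Lemma continuous_fcomp (f g : R -> R) : continuous f -> continuous g ->
  continuous (fun x => g (f x)).
Proof. by move=> cf cg x; exact: (continuous_comp (cf x) (cg (f x))). Qed.

Lemma continuous_scale (k : R) : continuous (fun x : R => k * x).
Proof. by apply: continuous_mul => x; [exact: cst_continuous|exact: cvg_id]. Qed.

Lemma continuous_opp (f : R -> R) : continuous f -> continuous (fun x => - f x).
Proof. by move=> cf x; exact: (continuousN (cf x)). Qed.

Lemma continuous_inv (f : R -> R) : continuous f -> (forall x, f x != 0) ->
  continuous (fun x => (f x)^-1).
Proof. by move=> cf f0 x; exact: (cvgV (f0 x) (cf x)). Qed.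

Lemma continuous_normr : continuous (fun x : R => `|x|).
Proof. by move=> x; exact: (@norm_continuous _ R^o x). Qed.

Lemma is_derive_continuous (F F' : R -> R) :
  (forall x : R, is_derive x 1 F (F' x)) -> continuous F.
Proof.
move=> dF x; apply/differentiable_continuous/derivable1_diffP.
by case: (dF x).
Qed.

Lemma cvg_expRNy (k : R) : 0 < k -> expR (- (k * x)) @[x --> +oo] --> (0 : R).
Proof.
move=> k0; apply: (cvg_comp _ _ _ (@cvgr_expR R)).
apply/cvgryPge => A; near=> x; rewrite mulrC -ler_pdivrMr//; near: x.
Unshelve. all: by end_near. Qed.

(** A primitive of exp(- k t) (1 + cos(l t)). The added 1 makes the integrand nonnegative, as the
    fundamental theorem on a half-line asks; half of the case l = 0 is subtracted later to recover
    the cosine alone. *)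
Definition laplaceF (k l t : R) : R := - (expR (- (k * t)) *
  (k^-1 - (l * sin (l * t) - k * cos (l * t)) / (k ^+ 2 + l ^+ 2))).

Lemma is_derive_laplaceF (k l t : R) : 0 < k ->
  is_derive t 1 (laplaceF k l) (expR (- (k * t)) * (1 + cos (l * t))).
Proof.
move=> k0; have k2 : 0 < k ^+ 2 + l ^+ 2 by rewrite ltr_pwDl ?exprn_gt0 ?sqr_ge0.
apply: is_derive_eq; rewrite /GRing.scale /=; field.
by rewrite !gt_eqF.
Qed.

Lemma cvg_laplaceF (k l : R) : 0 < k -> laplaceF k l t @[t --> +oo] --> (0 : R).
Proof.
move=> k0.
pose C := k^-1 + (`|l| + k) / (k ^+ 2 + l ^+ 2).
have k2 : 0 < k ^+ 2 + l ^+ 2 by rewrite ltr_pwDl ?exprn_gt0 ?sqr_ge0.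
have hC t : `|laplaceF k l t| <= expR (- (k * t)) * C.
  rewrite /laplaceF normrN normrM ger0_norm ?expR_ge0// ler_wpM2l ?expR_ge0//.
  rewrite (le_trans (ler_normB _ _))// lerD//.
    by rewrite gtr0_norm// invr_gt0.
  rewrite normrM [`|_^-1|]gtr0_norm ?invr_gt0// ler_wpM2r ?invr_ge0 ?(ltW k2)//.
  rewrite (le_trans (ler_normB _ _))// !normrM lerD//.
    by rewrite ler_piMr// sin_max.
  by rewrite (gtr0_norm k0) ler_piMr ?(ltW k0)// cos_max.
have h0 : expR (- (k * t)) * C @[t --> +oo] --> (0 : R).
  by rewrite -(mul0r C); apply: cvgM; [exact: cvg_expRNy|exact: cvg_cst].
apply/norm_cvg0P; apply: (squeeze_cvgr _ (cvg_cst 0) h0).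
by apply: nearW => t; rewrite normr_ge0 hC.
Qed.

Lemma continuous_laplace (k l : R) :
  continuous (fun t : R => expR (- (k * `|t|)) * (1 + cos (l * t))).
Proof.
apply: continuous_mul.
  apply: (continuous_fcomp _ (@continuous_expR R)); apply: continuous_opp.
  by apply: (continuous_fcomp continuous_normr); exact: continuous_scale.
apply: continuous_add; first exact: cst_continuous.
by apply: (continuous_fcomp _ (@continuous_cos R)); exact: continuous_scale.
Qed.

Lemma laplace_ge0 (k l t : R) : 0 <= expR (- (k * `|t|)) * (1 + cos (l * t)).
Proof. by rewrite mulr_ge0 ?expR_ge0// -lerBlDl sub0r cos_geN1. Qed.

Lemma ge0_laplace (k l : R) : 0 < k ->
  (\int[mu]_t (expR (- (k * `|t|)) * (1 + cos (l * t)))%:E)%E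
    = (2 * (k^-1 + k / (k ^+ 2 + l ^+ 2)))%:E.
Proof.
move=> k0; have k2 : 0 < k ^+ 2 + l ^+ 2 by rewrite ltr_pwDl ?exprn_gt0 ?sqr_ge0.
rewrite (ge0_symfun_integralT (laplace_ge0 k l) (@continuous_laplace k l)); last first.
  by move=> t; rewrite /= normrN mulrN cosN.
rewrite EFinM; congr (_ * _)%E.
have -> : [set x : R | 0 <= x] = `[0, +oo[%classic.
  by apply/seteqP; split=> x /=; rewrite in_itv/= andbT.
transitivity (\int[mu]_(t in `[0%R, +oo[) (expR (- (k * t)) * (1 + cos (l * t)))%:E)%E.
  apply: eq_integral => t; rewrite inE/= in_itv/= andbT => t0.
  by rewrite ger0_norm.
rewrite (@ge0_continuous_FTC2y R _ (laplaceF k l) 0 0).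
- rewrite /laplaceF !mulr0 oppr0 expR0 sin0 cos0 -EFinB; congr EFin.
  by field; rewrite !gt_eqF.
- move=> t t0; have := laplace_ge0 k l t; by rewrite ger0_norm.
- apply: continuous_subspaceT; apply: is_derive_continuous => x.
- exact: cvg_laplaceF.
- by move=> x _; case: (is_derive_laplaceF l x k0).
- apply: cvg_at_right_filter; apply: is_derive_continuous => x.
- by move=> x _; rewrite derive1E; case: (is_derive_laplaceF l x k0).
Qed.

Lemma continuous_ge0_rintegrable (f : R -> R) (r : R) : continuous f ->
  (forall x, 0 <= f x) -> (\int[mu]_x (f x)%:E)%E = r%:E -> rintegrable mu f.
Proof.
move=> cf f0 fr; apply/integrableP; split.
  by apply/measurable_EFinP; exact: continuous_measurable_fun.
by under eq_integral do rewrite /= ger0_norm//; rewrite fr ltry.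
Qed.

Lemma rintegrable_expRN (k : R) : 0 < k ->
  rintegrable mu (fun t => expR (- (k * `|t|))).
Proof.
move=> k0.
have := continuous_ge0_rintegrable (@continuous_laplace k 0) (laplace_ge0 k 0)
  (ge0_laplace 0 k0).
move=> /(rintegrableZl 2^-1); apply: eq_integrable => // t _ /=.
by rewrite mul0r cos0; congr EFin; field.
Qed.

Lemma Rintegral_expRN_cos (k l : R) : 0 < k ->
  \int[mu]_t (expR (- (k * `|t|)) * cos (l * t)) = 2 * k / (k ^+ 2 + l ^+ 2).
Proof.
move=> k0; have k2 : 0 < k ^+ 2 + l ^+ 2 by rewrite ltr_pwDl ?exprn_gt0 ?sqr_ge0.
have hI m := continuous_ge0_rintegrable (@continuous_laplace k m) (laplace_ge0 k m)
  (ge0_laplace m k0).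
have hE m : \int[mu]_t (expR (- (k * `|t|)) * (1 + cos (m * t)))
    = 2 * (k^-1 + k / (k ^+ 2 + m ^+ 2)).
  by rewrite /Rintegral ge0_laplace.
transitivity (\int[mu]_t (expR (- (k * `|t|)) * (1 + cos (l * t)) -
    2^-1 * (expR (- (k * `|t|)) * (1 + cos (0 * t))))).
  by apply: eq_Rintegral => t _; rewrite mul0r cos0; field.
rewrite RintegralB// ?hE; last exact: rintegrableZl.
rewrite RintegralZl// hE expr0n addr0; field.
by rewrite !gt_eqF.
Qed.

Lemma continuous_cauchy : continuous (fun y : R => (1 + y ^+ 2)^-1).
Proof.
apply: continuous_inv => [|y]; last by rewrite gt_eqF// ltr_pwDl// sqr_ge0.
exact: (@is_derive_continuous (fun y => 1 + y ^+ 2)).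
Qed.

Lemma ge0_cauchy : (\int[mu]_y ((1 + y ^+ 2)^-1)%:E)%E = pi%:E.
Proof.
have K0 y : 0 <= ((1 + y ^+ 2)^-1 : R) by rewrite invr_ge0 addr_ge0// sqr_ge0.
rewrite (ge0_symfun_integralT K0 continuous_cauchy); last first.
  by move=> y; rewrite /= sqrrN.
have -> : [set x : R | 0 <= x] = `[0, +oo[%classic.
  by apply/seteqP; split=> x /=; rewrite in_itv/= andbT.
rewrite (@ge0_continuous_FTC2y R _ atan 0 (pi / 2)).
- by rewrite atan0 sube0 -EFinM; congr EFin; field.
- by [].
- apply: continuous_subspaceT; exact: continuous_cauchy.
- exact: cvgy_atan.
- by [].
- by apply: cvg_at_right_filter; exact: continuous_atan.
- by move=> x _; rewrite derive1_atan.
Qed.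

Lemma rintegrable_cauchy : rintegrable mu (fun y => (1 + y ^+ 2)^-1).
Proof.
apply: (continuous_ge0_rintegrable continuous_cauchy _ ge0_cauchy) => y.
by rewrite invr_ge0 addr_ge0// sqr_ge0.
Qed.

Lemma Rintegral_cauchy : \int[mu]_y (1 + y ^+ 2)^-1 = pi.
Proof. by rewrite /Rintegral ge0_cauchy. Qed.

(** The Abel weight exp(- k |t|) makes the double integrand absolutely integrable, so the integrals
    can be exchanged; the integral over t is then the Poisson kernel centred at l. *)
Lemma Rintegral_poisson (g : R -> R) (l k : R) : 0 < k -> rintegrable mu g ->
  \int[mu]_t (expR (- (k * `|t|)) * \int[mu]_w (g w * cos (t * (w - l))))
  = \int[mu]_w (g w * (2 * k / (k ^+ 2 + (w - l) ^+ 2))).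
Proof.
move=> k0 gi; have mg := rintegrable_measurable gi.
pose f (z : R * R) := expR (- (k * `|z.1|)) * (g z.2 * cos (z.1 * (z.2 - l))).
have mexp : measurable_fun setT (fun t : R => expR (- (k * `|t|))).
  exact: rintegrable_measurable (rintegrable_expRN k0).
have mcos : measurable_fun setT (fun z : R * R => cos (z.1 * (z.2 - l))).
  apply: measurableT_comp; first exact: continuous_measurable_fun (@continuous_cos R).
  by apply: measurable_funM => //; apply: measurable_funB.
have mf : measurable_fun setT f.
  apply: measurable_funM.
    exact: (measurableT_comp mexp (@measurable_fst _ _ R R)).
  by apply: measurable_funM => //; exact: measurableT_comp.
have fi1 t : rintegrable mu (fun w => g w * cos (t * (w - l))).
  apply: (rintegrable_le _ _ (rintegrable_norm gi)).
    apply: measurable_funM => //.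
    exact: (measurableT_comp mcos (measurable_pair1 t)).
  by move=> w; rewrite normrM ler_piMr// cos_max.
have fi : rintegrable (mu \x mu)%E f.
  apply: (@rintegrable_prod_le _ _ _ _ _ mu mu _ _ _ mf _ (rintegrable_expRN k0) (rintegrable_norm gi)).
  move=> t w; rewrite /f/= normrM ger0_norm ?expR_ge0// ler_wpM2l ?expR_ge0//.
  by rewrite normrM ler_piMr// cos_max.
have fi2 w : rintegrable mu (fun t => f (t, w)).
  rewrite /f/=.
  have := rintegrableZl `|g w| (rintegrable_expRN k0); apply: rintegrable_le.
    exact: (measurableT_comp mf (measurable_pair2 w)).
  move=> t; rewrite normrM ger0_norm ?expR_ge0// mulrC ler_wpM2r ?expR_ge0//.
  by rewrite normrM ler_piMr// cos_max.
transitivity (\int[mu]_t \int[mu]_w f (t, w)).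
  by apply: eq_Rintegral => t _; rewrite /f/= RintegralZl.
have fi3 t : rintegrable mu (fun w => f (t, w)) by exact: (rintegrableZl (expR (- (k * `|t|))) (fi1 t)).
rewrite (@Rintegral12_prod _ _ _ _ _ mu mu f fi fi3).
rewrite -(@Rintegral21_prod _ _ _ _ _ mu mu f fi fi2); apply: eq_Rintegral => w _.
rewrite -Rintegral_expRN_cos// -RintegralZl//.
  by apply: eq_Rintegral => t _; rewrite /f/= mulrCA [t * _]mulrC.
apply: (rintegrable_le _ _ (rintegrable_expRN k0)).
  apply: measurable_funM => //.
  exact: continuous_measurable_fun (continuous_fcomp (@continuous_scale (w - l)) (@continuous_cos R)).
by move=> t; rewrite normrM ger0_norm ?expR_ge0// ler_piMr ?expR_ge0// cos_max.
Qed.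

(** Abel summation: the Poisson kernel of width k tends to 2 pi times the point mass at l as k -> 0.
    Only the cosine appears, since the sine half of the inversion integral is odd in t. *)
Lemma Fourier_inversion (g : R -> R) (C l : R) :
  continuous g -> (forall w, `|g w| <= C) -> rintegrable mu g ->
  rintegrable mu (fun t => \int[mu]_w (g w * cos (t * (w - l)))) ->
  \int[mu]_t \int[mu]_w (g w * cos (t * (w - l))) = 2 * pi * g l.
Proof.
move=> cg gC gi; set phi := fun t => _ => phii.
have mg := rintegrable_measurable gi; have mphi := rintegrable_measurable phii.
pose k n : R := n.+1%:R^-1.
have k0 n : 0 < k n by rewrite invr_gt0.
have kcvg : k n @[n --> \oo] --> (0 : R) by exact: cvg_harmonic.
have kcvg0 y : k n * y @[n --> \oo] --> (0 : R).
  by rewrite -(mul0r y); apply: cvgM => //; exact: cvg_cst.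
pose A n := \int[mu]_t (expR (- (k n * `|t|)) * phi t).
(* Removing the Abel weight is dominated by |phi|. *)
have A1 : A n @[n --> \oo] --> \int[mu]_t phi t.
  apply: (Rintegral_dominated_cvg _ _ _ (rintegrable_norm phii)) => //.
  - move=> n; apply: measurable_funM => //.
    exact: rintegrable_measurable (rintegrable_expRN (k0 n)).
  - move=> t; rewrite -[X in _ --> X]mul1r; apply: cvgM; last exact: cvg_cst.
    rewrite -expR0 -[X in expR X]oppr0.
    apply: (cvg_comp _ _ (cvgN (kcvg0 `|t|))); exact: continuous_expR.
  - move=> n t; rewrite normrM ler_piMl// ger0_norm ?expR_ge0//.
    by rewrite expR_le1 oppr_le0 mulr_ge0 ?normr_ge0// ltW.
have cg' n : continuous (fun y : R => g (l + k n * y)).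
  apply: (continuous_fcomp _ cg); apply: continuous_add; first exact: cst_continuous.
  exact: continuous_scale.
have gci n : rintegrable mu (fun y => g (l + k n * y) * (1 + y ^+ 2)^-1).
  apply: (rintegrable_le _ _ (rintegrableZl C rintegrable_cauchy)).
    exact: continuous_measurable_fun (continuous_mul (cg' n) continuous_cauchy).
  move=> y; rewrite normrM ler_pM ?normr_ge0//.
  by rewrite ger0_norm// invr_ge0 addr_ge0// sqr_ge0.
(* The rescaling w = l + k y turns the Poisson kernel into the fixed weight 2 / (1 + y^2), so the
   limit k -> 0 acts on g alone and C / (1 + y^2) dominates. *)
have AE n : A n = 2 * \int[mu]_y (g (l + k n * y) * (1 + y ^+ 2)^-1).
  rewrite /A Rintegral_poisson//.
  have kD w : 0 < k n ^+ 2 + (w - l) ^+ 2.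
    by rewrite ltr_pwDl ?sqr_ge0 ?exprn_gt0.
  have hG : rintegrable mu (fun w => g w * (2 * k n / (k n ^+ 2 + (w - l) ^+ 2))).
    apply: (rintegrable_le _ _ (rintegrableZl (2 * (k n)^-1) (rintegrable_norm gi))).
      apply: measurable_funM => //; apply: continuous_measurable_fun.
      apply: continuous_mul; first exact: cst_continuous.
      apply: continuous_inv => [|w]; last by rewrite gt_eqF.
      exact: (@is_derive_continuous (fun w => k n ^+ 2 + (w - l) ^+ 2)).
    move=> w; rewrite normrM mulrC ler_wpM2r// ger0_norm; last first.
      by rewrite mulr_ge0 ?(ltW (k0 _))// ?invr_ge0 ?(ltW (kD _))// mulr_ge0// ltW.
    rewrite ler_pdivrMr// -!mulrA ler_wpM2l// mulrC -ler_pdivrMr ?invr_gt0// invrK.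
    by rewrite -expr2 lerDl sqr_ge0.
  rewrite -(Rintegral_affine l (k0 n) hG).
  rewrite -!RintegralZl//; last exact: (rintegrable_affine l (k0 n) hG).
  apply: eq_Rintegral => y _.
  rewrite addrAC subrr add0r; field.
  by rewrite !gt_eqF// ?ltr_pwDl ?sqr_ge0 ?exprn_gt0.
have A2 : A n @[n --> \oo] --> 2 * (g l * pi).
  under eq_fun do rewrite AE.
  apply: cvgM; first exact: cvg_cst.
  rewrite -Rintegral_cauchy -RintegralZl//; last exact: rintegrable_cauchy.
  apply: (Rintegral_dominated_cvg _ _ _ (rintegrableZl C rintegrable_cauchy)).
  - by move=> n; exact: rintegrable_measurable (gci n).
  - exact: rintegrable_measurable (rintegrableZl (g l) rintegrable_cauchy).
  - move=> y; apply: cvgM; last exact: cvg_cst.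
    rewrite -[X in _ --> g X]addr0.
    apply: (cvg_comp _ _ (cvgD (cvg_cst l) (kcvg0 y))); exact: cg.
  - move=> n y; rewrite normrM ler_pM ?normr_ge0//.
    by rewrite ger0_norm// invr_ge0 addr_ge0// sqr_ge0.
by rewrite (cvg_unique _ A1 A2)//; ring.
Qed.

(** * Euler's Gamma function on vertical lines *)

(** Fubini gives measurability of a parameter integral when the integrand is integrable on the
    product; the weight exp(- |t|) ensures this and is divided out at the end. *)
Lemma measurable_Rintegral_param (g psi : R -> R) : rintegrable mu g ->
  continuous psi -> (forall x, `|psi x| <= 1) ->
  measurable_fun setT (fun t : R => \int[mu]_w (g w * psi (t * w))).
Proof.
move=> gi cpsi psi1; have mg := rintegrable_measurable gi.
have mpsi := continuous_measurable_fun cpsi.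
pose f (z : R * R) := expR (- (1 * `|z.1|)) * (g z.2 * psi (z.1 * z.2)).
have mexp : measurable_fun setT (fun t : R => expR (- (1 * `|t|))).
  exact: rintegrable_measurable (rintegrable_expRN ltr01).
have mf : measurable_fun setT f.
  apply: measurable_funM.
    exact: (measurableT_comp mexp (@measurable_fst _ _ R R)).
  apply: measurable_funM; first exact: measurableT_comp.
  by apply: measurableT_comp => //; exact: measurable_funM.
have fi1 t : rintegrable mu (fun w => g w * psi (t * w)).
  apply: (rintegrable_le _ _ (rintegrable_norm gi)).
    apply: measurable_funM => //; apply: measurableT_comp => //.
  by move=> w; rewrite normrM ler_piMr.
have fi : rintegrable (mu \x mu)%E f.
  apply: (@rintegrable_prod_le _ _ _ _ _ mu mu _ _ _ mf _ (rintegrable_expRN ltr01) (rintegrable_norm gi)).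
  move=> t w; rewrite /f/= normrM ger0_norm ?expR_ge0// ler_wpM2l ?expR_ge0//.
  by rewrite normrM ler_piMr.
have fi3 t : rintegrable mu (fun w => f (t, w)).
  exact: (rintegrableZl (expR (- (1 * `|t|))) (fi1 t)).
have /rintegrable_measurable := @rintegrable_prod12 _ _ _ _ _ mu mu f fi fi3.
move=> /(measurable_funM (f := fun t : R => expR (1 * `|t|))).
move=> /(_ _)/= h.
apply: (eq_measurable_fun (fun t : R => expR (1 * `|t|) * \int[mu]_w f (t, w))).
  by move=> t _; rewrite /f/= RintegralZl// mulrA -expRD subrr expR0 mul1r.
apply: h; apply: continuous_measurable_fun.
apply: (continuous_fcomp _ (@continuous_expR R)).
by apply: (continuous_fcomp continuous_normr); exact: continuous_scale.
Qed.

(** The function h_a: the measure u^(a-1) e^(-u) du of Euler's integral in the variable w = ln u. *)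
Definition gker (a w : R) : R := expR (a * w - expR w).

Lemma gker_ge0 a w : 0 <= gker a w. Proof. exact: expR_ge0. Qed.

Lemma gkerD1 a w : gker (a + 1) w = expR w * gker a w.
Proof. by rewrite /gker -expRD; congr expR; ring. Qed.

Lemma is_derive_gker (a w : R) : is_derive w 1 (gker a) (a * gker a w - gker (a + 1) w).
Proof.
rewrite gkerD1; apply: is_derive_eq; rewrite /GRing.scale /=.
by rewrite /gker; ring.
Qed.

Lemma continuous_gker a : continuous (gker a).
Proof. by apply: is_derive_continuous => w; exact: is_derive_gker. Qed.

(** For w >= 0, e^w dominates w^2 / 2 and the constant 2 a^2 completes the square (2 a - w)^2 / 2;
    for w < 0 the factor e^(a w) already decays. *)
Lemma gker_le a w : 0 < a -> gker a w <= expR (2 * a ^+ 2) * expR (- (a * `|w|)).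
Proof.
move=> a0; rewrite /gker -expRD ler_expR.
have [w0|w0] := leP 0 w.
  have : 1 + w ^+ 2 / 2 <= expR w by exact: (@expR_ge1Dxn R w 1).
  rewrite ger0_norm//; have := sqr_ge0 (2 * a - w); nra.
rewrite ltr0_norm//; have := expR_ge0 w; have := sqr_ge0 a; nra.
Qed.

Lemma gker_bound a w : 0 < a -> gker a w <= expR (2 * a ^+ 2).
Proof.
move=> a0; rewrite (le_trans (gker_le w a0))// ler_piMr ?expR_ge0// expR_le1.
by rewrite oppr_le0 mulr_ge0// ltW.
Qed.

Lemma rintegrable_gker a : 0 < a -> rintegrable mu (gker a).
Proof.
move=> a0; apply: (rintegrable_le _ _ (rintegrableZl (expR (2 * a ^+ 2)) (rintegrable_expRN a0))).
  exact: continuous_measurable_fun (@continuous_gker a).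
by move=> w; rewrite ger0_norm ?gker_ge0// gker_le.
Qed.

Lemma rintegrable_gkerM a (psi : R -> R) : 0 < a -> measurable_fun setT psi ->
  (forall x, `|psi x| <= 1) -> rintegrable mu (fun w => gker a w * psi w).
Proof.
move=> a0 mpsi psi1; apply: (rintegrable_le _ _ (rintegrable_gker a0)).
  apply: measurable_funM => //.
  exact: continuous_measurable_fun (@continuous_gker a).
by move=> w; rewrite normrM (ger0_norm (gker_ge0 _ _)) ler_piMr ?gker_ge0.
Qed.

(** [gcos a t] and [gsin a t] are the real and imaginary parts of Gamma(a + i t), as
    [Gamma_gcos_gsin] shows. *)
Definition gcos (a t : R) := \int[mu]_w (gker a w * cos (t * w)).
Definition gsin (a t : R) := \int[mu]_w (gker a w * sin (t * w)).

Lemma measurable_cosZ (t : R) : measurable_fun setT (fun w : R => cos (t * w)).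
Proof.
exact: continuous_measurable_fun (continuous_fcomp (@continuous_scale t) (@continuous_cos R)).
Qed.

Lemma measurable_sinZ (t : R) : measurable_fun setT (fun w : R => sin (t * w)).
Proof.
exact: continuous_measurable_fun (continuous_fcomp (@continuous_scale t) (@continuous_sin R)).
Qed.

Lemma rintegrable_gker_cos a t : 0 < a -> rintegrable mu (fun w => gker a w * cos (t * w)).
Proof.
move=> a0; apply: rintegrable_gkerM => //; first exact: measurable_cosZ.
by move=> x; exact: cos_max.
Qed.

Lemma rintegrable_gker_sin a t : 0 < a -> rintegrable mu (fun w => gker a w * sin (t * w)).
Proof.
move=> a0; apply: rintegrable_gkerM => //; first exact: measurable_sinZ.
by move=> x; exact: sin_max.
Qed.

Lemma cvg0_gkerM a (psi : R -> R) : 0 < a -> (forall x, `|psi x| <= 1) ->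
  gker a w * psi w @[w --> +oo] --> (0 : R) /\
  gker a w * psi w @[w --> -oo] --> (0 : R).
Proof.
move=> a0 psi1.
have hb w : `|gker a w * psi w| <= expR (2 * a ^+ 2) * expR (- (a * `|w|)).
  by rewrite normrM (le_trans _ (gker_le w a0))// (ger0_norm (gker_ge0 _ _)) ler_piMr ?gker_ge0.
have h0 : expR (2 * a ^+ 2) * expR (- (a * w)) @[w --> +oo] --> (0 : R).
  by rewrite -(mulr0 (expR (2 * a ^+ 2))); apply: cvgM; [exact: cvg_cst|exact: cvg_expRNy].
split.
  apply/norm_cvg0P; apply: (squeeze_cvgr _ (cvg_cst 0) h0).
  apply: nearW => w; rewrite normr_ge0 (le_trans (hb w))// ler_wpM2l ?expR_ge0//.
  by rewrite ler_expR lerN2 ler_wpM2l ?(ltW a0)// ler_norm.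
apply/cvgNy_compNP; apply/norm_cvg0P; apply: (squeeze_cvgr _ (cvg_cst 0) h0).
apply: nearW => w; rewrite normr_ge0 (le_trans (hb (- w)))// ler_wpM2l ?expR_ge0//.
by rewrite ler_expR lerN2 ler_wpM2l ?(ltW a0)// normrN ler_norm.
Qed.

(** Integration by parts: the derivative of [gker a w * cos (t * w)] has integral 0. Together with
    [gsinD1] this is Gamma(z + 1) = z Gamma(z) at z = a + i t. *)
Lemma gcosD1 a t : 0 < a -> gcos (a + 1) t = a * gcos a t - t * gsin a t.
Proof.
move=> a0; have a1 : 0 < a + 1 by rewrite addr_gt0.
have ic := rintegrable_gker_cos t a0; have is_ := rintegrable_gker_sin t a0.
have ic1 := rintegrable_gker_cos t a1.
pose f w := (a * (gker a w * cos (t * w)) - t * (gker a w * sin (t * w))) -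
  gker (a + 1) w * cos (t * w).
have iB : rintegrable mu (fun w => a * (gker a w * cos (t * w)) - t * (gker a w * sin (t * w))).
  by apply: rintegrableB; exact: rintegrableZl.
have [h1 h2] := cvg0_gkerM a0 (fun x => cos_max (t * x)).
have dF (w : R) : is_derive w 1 (fun w => gker a w * cos (t * w)) (f w).
  have := is_derive_gker a w => ?.
  by apply: is_derive_eq; rewrite /GRing.scale /= /f; ring.
have cf : continuous f.
  have cc := continuous_fcomp (@continuous_scale t) (@continuous_cos R).
  have cs := continuous_fcomp (@continuous_scale t) (@continuous_sin R).
  apply: continuous_add; last first.
    by apply: continuous_opp; apply: continuous_mul => //; exact: continuous_gker.
  apply: continuous_add.
    apply: continuous_mul; first exact: cst_continuous.
    by apply: continuous_mul => //; exact: continuous_gker.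
  apply: continuous_opp; apply: continuous_mul; first exact: cst_continuous.
  by apply: continuous_mul => //; exact: continuous_gker.
have := Rintegral_derive_eq0 dF cf (rintegrableB iB ic1) h1 h2.
rewrite /f RintegralB// RintegralB//; [|exact: rintegrableZl|exact: rintegrableZl].
by rewrite !RintegralZl// => /subr0_eq/esym.
Qed.

Lemma gsinD1 a t : 0 < a -> gsin (a + 1) t = a * gsin a t + t * gcos a t.
Proof.
move=> a0; have a1 : 0 < a + 1 by rewrite addr_gt0.
have ic := rintegrable_gker_cos t a0; have is_ := rintegrable_gker_sin t a0.
have ic1 := rintegrable_gker_sin t a1.
pose f w := (a * (gker a w * sin (t * w)) + t * (gker a w * cos (t * w))) -
  gker (a + 1) w * sin (t * w).
have iB : rintegrable mu (fun w => a * (gker a w * sin (t * w)) + t * (gker a w * cos (t * w))).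
  by apply: rintegrableD; exact: rintegrableZl.
have [h1 h2] := cvg0_gkerM a0 (fun x => sin_max (t * x)).
have dF (w : R) : is_derive w 1 (fun w => gker a w * sin (t * w)) (f w).
  have := is_derive_gker a w => ?.
  by apply: is_derive_eq; rewrite /GRing.scale /= /f; ring.
have cf : continuous f.
  have cc := continuous_fcomp (@continuous_scale t) (@continuous_cos R).
  have cs := continuous_fcomp (@continuous_scale t) (@continuous_sin R).
  apply: continuous_add; last first.
    by apply: continuous_opp; apply: continuous_mul => //; exact: continuous_gker.
  apply: continuous_add.
    apply: continuous_mul; first exact: cst_continuous.
    by apply: continuous_mul => //; exact: continuous_gker.
  apply: continuous_mul; first exact: cst_continuous.
  by apply: continuous_mul => //; exact: continuous_gker.
have := Rintegral_derive_eq0 dF cf (rintegrableB iB ic1) h1 h2.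
rewrite /f RintegralB// RintegralD//; [|exact: rintegrableZl|exact: rintegrableZl].
by rewrite !RintegralZl// => /subr0_eq/esym.
Qed.
End RealLine.

(** * Decay of Gamma and the Cahen-Mellin integral *)

Section CahenMellin.
Context (R : realType).
Local Notation mu := (@lebesgue_measure R).
Implicit Types a t l : R.

Definition gam (a : R) := \int[mu]_w gker a w.

Lemma gcos0 a : gcos a 0 = gam a.
Proof. by apply: eq_Rintegral => w _; rewrite mul0r cos0 mulr1. Qed.

Lemma gsin0 a : gsin a 0 = 0.
Proof.
rewrite /gsin; under eq_Rintegral do rewrite mul0r sin0 mulr0.
by rewrite /Rintegral integral0.
Qed.

Lemma gamD1 a : 0 < a -> gam (a + 1) = a * gam a.
Proof. by move=> a0; rewrite -!gcos0 gcosD1// mul0r subr0. Qed.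

Lemma gcos_le a t : 0 < a -> `|gcos a t| <= gam a.
Proof.
move=> a0; have ic := rintegrable_gker_cos t a0.
rewrite (le_trans (le_normr_Rintegral measurableT ic))//.
apply: le_Rintegral => //; [exact: rintegrable_norm|exact: rintegrable_gker|].
by move=> w _; rewrite normrM (ger0_norm (gker_ge0 _ _)) ler_piMr ?gker_ge0// cos_max.
Qed.

Lemma gsin_le a t : 0 < a -> `|gsin a t| <= gam a.
Proof.
move=> a0; have ic := rintegrable_gker_sin t a0.
rewrite (le_trans (le_normr_Rintegral measurableT ic))//.
apply: le_Rintegral => //; [exact: rintegrable_norm|exact: rintegrable_gker|].
by move=> w _; rewrite normrM (ger0_norm (gker_ge0 _ _)) ler_piMr ?gker_ge0// sin_max.
Qed.

Lemma Rintegral_ge_itv (f : R -> R) (c b : R) : rintegrable mu f -> 0 <= c ->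
  (forall x, 0 <= f x) -> (forall x, b <= x <= b + 1 -> c <= f x) ->
  c <= \int[mu]_x f x.
Proof.
move=> fi c0 f0 cf.
have := @Rintegral_ge_on _ _ _ mu `[b, b + 1]%classic f c 1 (measurable_itv _).
rewrite mulr1; apply => //.
by rewrite /= lebesgue_measure_itv/= lte_fin ltrDl ltr01 -EFinD addrAC subrr add0r.
Qed.

Lemma gam_gt0 a : 0 < a -> 0 < gam a.
Proof.
move=> a0; apply: (@lt_le_trans _ _ (expR (- expR 1))); first exact: expR_gt0.
apply: (@Rintegral_ge_itv _ _ 0); [exact: rintegrable_gker|exact: expR_ge0|exact: gker_ge0|].
move=> w; rewrite add0r => /andP[w0 w1]; rewrite ler_expR.
by rewrite -[leLHS]add0r lerD ?mulr_ge0 ?(ltW a0)// lerN2 ler_expR.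
Qed.

Lemma gcos_gsinD1 a t : 0 < a ->
  gcos (a + 1) t ^+ 2 + gsin (a + 1) t ^+ 2 =
  (a ^+ 2 + t ^+ 2) * (gcos a t ^+ 2 + gsin a t ^+ 2).
Proof. by move=> a0; rewrite gcosD1// gsinD1//; ring. Qed.

(** Two steps of the functional equation lead to Gamma(a + 2 + i t), which is bounded by Gamma(a +
    2), and each step gains a factor |a + i t| at least. The resulting bound of order 1 / (a^2 +
    t^2) is integrable over t. *)
Lemma gcos_gsin_decay a t : 0 < a ->
  (a ^+ 2 + t ^+ 2) ^+ 2 * (gcos a t ^+ 2 + gsin a t ^+ 2) <= (2 * gam (a + 1 + 1)) ^+ 2.
Proof.
move=> a0; have a1 : 0 < a + 1 by rewrite addr_gt0.
have a2 : 0 < a + 1 + 1 by rewrite addr_gt0.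
apply: (@le_trans _ _ (gcos (a + 1 + 1) t ^+ 2 + gsin (a + 1 + 1) t ^+ 2)).
  rewrite gcos_gsinD1// gcos_gsinD1// expr2 -mulrA ler_wpM2r//.
    by rewrite mulr_ge0// addr_ge0// sqr_ge0.
  by rewrite lerD2r ler_sqr ?nnegrE ?(ltW a0) ?(ltW a1)// lerDl.
have h1 : gcos (a + 1 + 1) t ^+ 2 <= gam (a + 1 + 1) ^+ 2.
  by rewrite -real_normK ?num_real// ler_sqr ?nnegrE ?normr_ge0// ?gcos_le ?(ltW (gam_gt0 _)).
have h2 : gsin (a + 1 + 1) t ^+ 2 <= gam (a + 1 + 1) ^+ 2.
  by rewrite -real_normK ?num_real// ler_sqr ?nnegrE ?normr_ge0// ?gsin_le ?(ltW (gam_gt0 _)).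
by rewrite exprMn (le_trans (lerD h1 h2))//; have := sqr_ge0 (gam (a + 1 + 1)); lra.
Qed.

(** The constant comes from 1 + t^2 <= (1 + 1 / a^2) (a^2 + t^2). *)
Lemma cauchy_bound (a t c N : R) : 0 < a -> 0 <= N ->
  (a ^+ 2 + t ^+ 2) ^+ 2 * c ^+ 2 <= N ^+ 2 ->
  `|c| <= N * (1 + (a ^+ 2)^-1) * (1 + t ^+ 2)^-1.
Proof.
move=> a0 N0; have at0 : 0 < a ^+ 2 + t ^+ 2 by rewrite ltr_pwDl ?sqr_ge0 ?exprn_gt0.
rewrite -exprMn -real_normK ?num_real// ler_sqr ?nnegrE ?normr_ge0//.
rewrite normrM gtr0_norm// mulrC -ler_pdivlMr// => /le_trans; apply.
rewrite -mulrA ler_wpM2l//.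
have t1 : 0 < 1 + t ^+ 2 by rewrite ltr_pwDl ?sqr_ge0.
have a2 : 0 < a ^+ 2 by rewrite exprn_gt0.
rewrite ler_pdivlMr// mulrC ler_pdivrMr// mulrDl mul1r mulrDr mulVf ?gt_eqF//.
have : 0 <= (a ^+ 2)^-1 * t ^+ 2 by rewrite mulr_ge0 ?invr_ge0 ?sqr_ge0.
by have := sqr_ge0 a; lra.
Qed.

Definition gbound (a : R) := 2 * gam (a + 1 + 1) * (1 + (a ^+ 2)^-1).

Lemma gcos_decay a t : 0 < a -> `|gcos a t| <= gbound a * (1 + t ^+ 2)^-1.
Proof.
move=> a0; apply: cauchy_bound => //.
  by rewrite mulr_ge0// ltW// gam_gt0// !addr_gt0.
rewrite (le_trans _ (gcos_gsin_decay t a0))// ler_wpM2l ?sqr_ge0//.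
by rewrite lerDl sqr_ge0.
Qed.

Lemma gsin_decay a t : 0 < a -> `|gsin a t| <= gbound a * (1 + t ^+ 2)^-1.
Proof.
move=> a0; apply: cauchy_bound => //.
  by rewrite mulr_ge0// ltW// gam_gt0// !addr_gt0.
rewrite (le_trans _ (gcos_gsin_decay t a0))// ler_wpM2l ?sqr_ge0//.
by rewrite lerDr sqr_ge0.
Qed.

Lemma measurable_gcos a : 0 < a -> measurable_fun setT (gcos a).
Proof.
move=> a0; apply: measurable_Rintegral_param; first exact: rintegrable_gker.
  exact: continuous_cos.
exact: cos_max.
Qed.

Lemma measurable_gsin a : 0 < a -> measurable_fun setT (gsin a).
Proof.
move=> a0; apply: measurable_Rintegral_param; first exact: rintegrable_gker.
  exact: continuous_sin.
exact: sin_max.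
Qed.

Lemma Rintegral_gker_cosB a t l : 0 < a ->
  \int[mu]_w (gker a w * cos (t * (w - l))) = gcos a t * cos (t * l) + gsin a t * sin (t * l).
Proof.
move=> a0; have ic := rintegrable_gker_cos t a0; have is_ := rintegrable_gker_sin t a0.
rewrite -!RintegralZr// -RintegralD//; last 2 first.
- rewrite (_ : _ \o _ = EFin \o (fun w => cos (t * l) * (gker a w * cos (t * w)))).
    exact: rintegrableZl.
  by apply/funext => w /=; rewrite mulrC.
- rewrite (_ : _ \o _ = EFin \o (fun w => sin (t * l) * (gker a w * sin (t * w)))).
    exact: rintegrableZl.
  by apply/funext => w /=; rewrite mulrC.
by apply: eq_Rintegral => w _; rewrite mulrBr cosB; ring.
Qed.

Lemma rintegrable_gcos_gsin a l : 0 < a ->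
  rintegrable mu (fun t => gcos a t * cos (t * l) + gsin a t * sin (t * l)).
Proof.
move=> a0; have mg := measurable_gcos a0; have ms := measurable_gsin a0.
have hl : continuous (fun t : R => t * l).
  by apply: continuous_mul => t; [exact: cvg_id|exact: cst_continuous].
apply: (rintegrable_le _ _ (rintegrableZl (2 * gbound a) (rintegrable_cauchy R))).
  apply: measurable_funD; apply: measurable_funM => //.
    exact: continuous_measurable_fun (continuous_fcomp hl (@continuous_cos R)).
  exact: continuous_measurable_fun (continuous_fcomp hl (@continuous_sin R)).
move=> t; rewrite -mulrA mulr_natl mulr2n (le_trans (ler_normD _ _))// !normrM.
by apply: lerD; [apply: le_trans (gcos_decay t a0)|apply: le_trans (gsin_decay t a0)];
  rewrite ler_piMr ?normr_ge0 ?cos_max ?sin_max.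
Qed.

(* Cahen-Mellin: the inverse Mellin transform of Gamma is exp (-x), here in the
   variable x = e^l and shifted to the line Re s = a. *)
Lemma Cahen_Mellin a l : 0 < a ->
  \int[mu]_t (gcos a t * cos (t * l) + gsin a t * sin (t * l)) = 2 * pi * gker a l.
Proof.
move=> a0; rewrite -(@Fourier_inversion R (gker a) (expR (2 * a ^+ 2)) l).
- by apply: eq_Rintegral => t _; rewrite Rintegral_gker_cosB.
- exact: continuous_gker.
- by move=> w; rewrite ger0_norm ?gker_ge0// gker_bound.
- exact: rintegrable_gker.
- apply: eq_integrable (rintegrable_gcos_gsin l a0) => // t _ /=.
  by rewrite Rintegral_gker_cosB.
Qed.

(** * Absence of zeros of Gamma in the right half-plane *)

Lemma normr_sin_le (u : R) : `|sin u| <= `|u|.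
Proof.
have h (v : R) : 0 < v -> `|sin v| <= v.
  move=> v0.
  have [c _] := @MVT R sin cos 0 v v0 (fun x _ => is_derive_sin x)
    (continuous_subspaceT (@continuous_sin R)).
  rewrite sin0 !subr0 => ->; rewrite normrM (gtr0_norm v0) ler_piMl ?(ltW v0)//.
  exact: cos_max.
have [u0|u0|->] := ltgtP u 0; last by rewrite sin0.
- by rewrite -normrN -sinN (ltr0_norm u0) h// oppr_gt0.
- by rewrite (gtr0_norm u0) h.
Qed.

Lemma cos_ge (u : R) : 1 - u ^+ 2 / 2 <= cos u.
Proof.
have -> : cos u = 1 - 2 * sin (u / 2) ^+ 2.
  rewrite [in LHS](_ : u = (u / 2) *+ 2); last by rewrite -mulr_natr; field.
  by rewrite cos_mulr2n -mulr_natr; have := cos2Dsin2 (u / 2); lra.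
have : sin (u / 2) ^+ 2 <= (u / 2) ^+ 2.
  by rewrite -real_normK ?num_real// -[leRHS]real_normK ?num_real// ler_sqr ?nnegrE ?normr_ge0// normr_sin_le.
lra.
Qed.

(** The bracket is (e^(x/2) - e^(-x/2))^2, and for x >= 0 the difference is at least (1 + x/2) - 1.
    The aim is to minorize the cosine by exponentials, whose integrals against [gker] are values of
    Gamma. *)
Lemma sqr_le_cosh (x : R) : x ^+ 2 <= 4 * (expR x - 2 + expR (- x)).
Proof.
wlog x0 : x / 0 <= x.
  move=> h; have [/h//|/ltW x0] := leP 0 x.
  by have := h (- x); rewrite oppr_ge0 sqrrN opprK => /(_ x0); lra.
have hp : expR x = expR (x / 2) ^+ 2 by rewrite expr2 -expRD; congr expR; field.
have hq : expR (- x) = expR (- (x / 2)) ^+ 2 by rewrite expr2 -expRD; congr expR; field.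
have pq : expR (x / 2) * expR (- (x / 2)) = 1 by rewrite -expRD subrr expR0.
have p1 := expR_ge1Dx (x / 2).
have q1 : expR (- (x / 2)) <= 1 by rewrite expR_le1 oppr_le0 divr_ge0.
rewrite hp hq.
set p := expR (x / 2) in p1 pq *; set q := expR (- (x / 2)) in q1 pq *.
have -> : p ^+ 2 - 2 + q ^+ 2 = (p - q) ^+ 2 by rewrite sqrrB pq; ring.
have : (x / 2) ^+ 2 <= (p - q) ^+ 2 by rewrite ler_sqr ?nnegrE; lra.
lra.
Qed.

(* Gamma(x + i t) x^{-i t} has positive real part for x large: the measure
   u^{x-1} e^{-u} du concentrates near u = x. *)
Lemma gcos_gsin_large (x t : R) : 1 + 2 * t ^+ 2 < x ->
  0 < gcos x t ^+ 2 + gsin x t ^+ 2.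
Proof.
move=> xt; have t2 := sqr_ge0 t.
have x1 : 0 < x - 1 by lra.
have x0 : 0 < x by lra.
have xS : 0 < x + 1 by lra.
rewrite lt_neqAle addr_ge0 ?sqr_ge0// andbT eq_sym; apply/eqP => /eqP.
rewrite paddr_eq0 ?sqr_ge0// !sqrf_eq0 => /andP[/eqP c0 /eqP s0].
have := Rintegral_gker_cosB t (ln x) x0; rewrite c0 s0 !mul0r addr0 => I0.
pose k := 2 * t ^+ 2.
(* A minorant of [gker x w * cos (t * (w - ln x))]: with y = w - ln x, cos(t y) >= 1 - k (e^y - 2 +
   e^(-y)), and multiplying [gker x] by e^w or e^(-w) shifts its parameter by 1. Its integral is (x
   - 1 - k) Gamma(x - 1), which is positive. *)
pose f w := (1 + 2 * k) * gker x w - k * x^-1 * gker (x + 1) w - k * x * gker (x - 1) w.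
have iA : rintegrable mu (fun w => (1 + 2 * k) * gker x w).
  exact: rintegrableZl (rintegrable_gker x0).
have iB : rintegrable mu (fun w => k * x^-1 * gker (x + 1) w).
  exact: rintegrableZl (rintegrable_gker xS).
have iC : rintegrable mu (fun w => k * x * gker (x - 1) w).
  exact: rintegrableZl (rintegrable_gker x1).
have iF : rintegrable mu f by exact: rintegrableB (rintegrableB iA iB) iC.
have gx : gam x = (x - 1) * gam (x - 1) by rewrite -gamD1// subrK.
have : \int[mu]_w f w <= \int[mu]_w (gker x w * cos (t * (w - ln x))).
  apply: le_Rintegral => //.
    apply: rintegrable_gkerM => // [|y]; last exact: cos_max.
    apply: continuous_measurable_fun; apply: (continuous_fcomp _ (@continuous_cos R)).
    apply: (@is_derive_continuous R (fun y => t * (y - ln x))) => y.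
  move=> w _; rewrite /f gkerD1.
  have hm : gker (x - 1) w = expR (- w) * gker x w.
    by rewrite /gker -expRD; congr expR; ring.
  rewrite hm; have -> : (1 + 2 * k) * gker x w - k / x * (expR w * gker x w) -
    k * x * (expR (- w) * gker x w) =
    gker x w * (1 - k * (expR w / x - 2 + x * expR (- w))) by ring.
  rewrite ler_wpM2l ?gker_ge0//.
  apply: le_trans (cos_ge _); rewrite lerD2l lerN2 exprMn -mulrA [k * _]mulrC /k.
  have := sqr_le_cosh (w - ln x).
  rewrite opprB !expRD !expRN !lnK ?posrE// => h.
  have := ler_wpM2l t2 h; lra.
rewrite I0 leNgt => /negP; apply.
rewrite RintegralB//; last exact: rintegrableB.
rewrite RintegralB// !RintegralZl//; [|exact: rintegrable_gker..].
rewrite -!/(gam _) gamD1// gx.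
have g1 := gam_gt0 x1.
have -> : (1 + 2 * k) * ((x - 1) * gam (x - 1)) -
   k / x * (x * ((x - 1) * gam (x - 1))) - k * x * gam (x - 1) =
   gam (x - 1) * (x - 1 - k) by field; rewrite gt_eqF.
by rewrite mulr_gt0// subr_gt0 /k; lra.
Qed.

(** By the functional equation a zero at a + i t would propagate to every a + n + i t, against
    [gcos_gsin_large] once n exceeds 1 + 2 t^2. *)
Lemma gcos_gsin_gt0 a t : 0 < a -> 0 < gcos a t ^+ 2 + gsin a t ^+ 2.
Proof.
move=> a0; rewrite lt_neqAle addr_ge0 ?sqr_ge0// andbT eq_sym; apply/eqP => h0.
have hn n : gcos (a + n%:R) t ^+ 2 + gsin (a + n%:R) t ^+ 2 = 0.
  elim: n => [|n IH]; first by rewrite addr0.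
  rewrite -natr1 addrA gcos_gsinD1 ?IH ?mulr0//.
  by rewrite ltr_pwDl.
have := @gcos_gsin_large (a + (Num.truncn (1 + 2 * t ^+ 2)).+1%:R) t.
by rewrite hn ltxx => h; apply/notF/h; rewrite ltr_wpDl ?(ltW a0)// truncnS_gt.
Qed.
End CahenMellin.

(** * The Beta integral *)

Section BetaIntegral.
Context (R : realType).
Local Notation mu := (@lebesgue_measure R).
Implicit Types a t l : R.

(** This is - ln r for r = 1 / (1 + e^x), the logarithmic variable of the Beta integral. *)
Definition softplus (x : R) : R := ln (1 + expR x).

Lemma expR_softplus x : expR (softplus x) = 1 + expR x.
Proof. by rewrite lnK// posrE addr_gt0// expR_gt0. Qed.

Lemma continuous_softplus : continuous softplus.
Proof.
apply: (@is_derive_continuous R _ (fun x => (1 + expR x)^-1 * expR x)) => x.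
have e0 : 0 < 1 + expR x by rewrite addr_gt0// expR_gt0.
have := is_derive1_ln e0 => dl.
have de : is_derive x 1 (fun x : R => 1 + expR x) (expR x).
  by apply: is_derive_eq; rewrite /GRing.scale /=; ring.
exact: is_derive1_comp.
Qed.

(* In the variable r = 1 / (1 + e^x) this is the density r^a (1 - r)^(-1/2) of
   Euler's integral for B(a, 1/2). *)
Definition bker (a x : R) : R := expR (x / 2 - (a + 2^-1) * softplus x).

Lemma bker_ge0 a x : 0 <= bker a x. Proof. exact: expR_ge0. Qed.

Lemma continuous_bker a : continuous (bker a).
Proof.
apply: (continuous_fcomp _ (@continuous_expR R)); apply: continuous_add.
  by apply: continuous_mul => x; [exact: cvg_id|exact: cst_continuous].
apply: continuous_opp; apply: (continuous_fcomp continuous_softplus).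
exact: continuous_scale.
Qed.

(** The integrand of the classical proof of Gamma(a) Gamma(1/2) = B(a, 1/2) Gamma(a + 1/2), with a
    test function psi. For fixed w, the substitution y = x + w gives the product of [gker a w] and
    [gker 2^-1 y]; for fixed x, translating w by [softplus x] gives [bker a x] times
    [gker (a + 2^-1)], because e^w + e^(x+w) = e^(w + softplus x). *)
Definition betaf a (psi : R -> R) (z : R * R) : R :=
  expR (z.1 / 2 + ((a + 2^-1) * z.2 - expR z.2 - expR (z.1 + z.2))) * psi z.2.

Lemma measurable_betaf a psi : continuous psi -> measurable_fun setT (betaf a psi).
Proof.
move=> cpsi; have mpsi := continuous_measurable_fun cpsi.
have mexp := @measurable_expR R.
apply: measurable_funM; last exact: measurableT_comp.
apply: measurableT_comp => //; apply: measurable_funD; first exact: measurable_funM.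
apply: measurable_funB; last by apply: measurableT_comp => //; exact: measurable_funD.
by apply: measurable_funB; [exact: measurable_funM|exact: measurableT_comp].
Qed.

Lemma betaf_shift a psi (x w : R) : betaf a psi (x, - softplus x + 1 * w) =
  bker a x * (gker (a + 2^-1) w * psi (w - softplus x)).
Proof.
rewrite /betaf/= mul1r [- _ + w]addrC mulrA -expRD; congr (expR _ * _).
rewrite expRD [expR (w - _)]expRD expRN expR_softplus.
have : 1 + expR x != 0 by rewrite gt_eqF// addr_gt0// expR_gt0.
move: (expR x) (expR w) (softplus x) => p q s p1; field.
exact: p1.
Qed.

Lemma betaf_shift2 a psi (y w : R) : betaf a psi (- w + 1 * y, w) =
  gker a w * psi w * gker 2^-1 y.
Proof.
rewrite /betaf/= mul1r mulrAC -expRD; congr (expR _ * _).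
by rewrite [- w + y]addrC subrK; field.
Qed.

Lemma half_gt0 : 0 < 2^-1 :> R. Proof. by rewrite invr_gt0. Qed.

Lemma rintegrable_betaf2 a psi w : rintegrable mu (fun x => betaf a psi (x, w)).
Proof.
have hE x : betaf a psi (x, w) = gker a w * psi w * gker 2^-1 (w + 1 * x).
  by rewrite -betaf_shift2 !mul1r addKr.
rewrite (_ : _ \o _ = EFin \o (fun x => gker a w * psi w * gker 2^-1 (w + 1 * x))).
  exact: (rintegrable_affine w ltr01 (rintegrableZl (gker a w * psi w) (rintegrable_gker half_gt0))).
by apply/funext => x; rewrite /= hE.
Qed.

Lemma Rintegral_betaf2 a psi w :
  \int[mu]_x betaf a psi (x, w) = gker a w * psi w * gam 2^-1.
Proof.
rewrite -(Rintegral_affine (- w) ltr01 (rintegrable_betaf2 a psi w)) mul1r.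
under eq_Rintegral do rewrite betaf_shift2.
by rewrite RintegralZl//; exact: rintegrable_gker.
Qed.

Lemma rintegrable_betaf1 a psi x : 0 < a -> continuous psi ->
  (forall w, `|psi w| <= 1) -> rintegrable mu (fun w => betaf a psi (x, w)).
Proof.
move=> a0 cpsi psi1; have a2 : 0 < a + 2^-1 by rewrite addr_gt0.
have cp : continuous (fun w => psi (w - softplus x)).
  by apply: (continuous_fcomp _ cpsi); apply: continuous_add => w; [exact: cvg_id|exact: cst_continuous].
have hE w : betaf a psi (x, w) =
    bker a x * (gker (a + 2^-1) (softplus x + 1 * w) * psi (softplus x + 1 * w - softplus x)).
  by rewrite -betaf_shift !mul1r addKr.
have := rintegrable_affine (softplus x) ltr01 (rintegrableZl (bker a x)
  (rintegrable_gkerM a2 (continuous_measurable_fun cp) (fun=> psi1 _))).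
rewrite (_ : _ \o _ = EFin \o (fun w => betaf a psi (x, w)))//.
by apply/funext => w; rewrite /= hE.
Qed.

Lemma Rintegral_betaf1 a psi x : 0 < a -> continuous psi -> (forall w, `|psi w| <= 1) ->
  \int[mu]_w betaf a psi (x, w) =
  bker a x * \int[mu]_w (gker (a + 2^-1) w * psi (w - softplus x)).
Proof.
move=> a0 cpsi psi1; have a2 : 0 < a + 2^-1 by rewrite addr_gt0.
rewrite -(Rintegral_affine (- softplus x) ltr01 (rintegrable_betaf1 x a0 cpsi psi1)) mul1r.
under eq_Rintegral do rewrite betaf_shift.
rewrite RintegralZl//; apply: rintegrable_gkerM => //.
apply: continuous_measurable_fun; apply: (continuous_fcomp _ cpsi).
by apply: continuous_add => w; [exact: cvg_id|exact: cst_continuous].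
Qed.

Lemma rintegrable_betaf a psi : 0 < a -> continuous psi -> (forall w, `|psi w| <= 1) ->
  rintegrable (mu \x mu)%E (betaf a psi).
Proof.
move=> a0 cpsi psi1.
have mb : measurable_fun setT (EFin \o betaf a psi).
  by apply/measurable_EFinP; exact: measurable_betaf.
have cnpsi : continuous (fun w => `|psi w|).
  by apply: (continuous_fcomp cpsi); exact: continuous_normr.
have gi : rintegrable mu (fun w => gker a w * `|psi w| * gam 2^-1).
  rewrite (_ : _ \o _ = EFin \o (fun w => gam 2^-1 * (gker a w * `|psi w|))).
    apply: rintegrableZl; apply: rintegrable_gkerM => //.
      exact: continuous_measurable_fun.
    by move=> w; rewrite normr_id.
  by apply/funext => w /=; rewrite mulrC.
have hE w : (\int[mu]_x `|(EFin \o betaf a psi) (x, w)| =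
    (gker a w * `|psi w| * gam 2^-1)%:E)%E.
  rewrite -(Rintegral_betaf2 a (fun w => `|psi w|)) EFin_Rintegral.
    apply: eq_integral => x _ /=.
    by rewrite /betaf /= normrM (ger0_norm (expR_ge0 _)).
  exact: rintegrable_betaf2.
apply/(@integrable21ltyP _ _ _ _ _ mu mu _ mb).
under eq_integral => w _ do rewrite hE.
by rewrite -EFin_Rintegral// ltry.
Qed.

(** The two orders of integration of [betaf]. For psi(w) = e^(i t w), taken through its real and
    imaginary parts, it yields the Mellin representation of Gamma(a + i t) / Gamma(a + 1/2 + i
    t). *)
Lemma bker_conv a psi : 0 < a -> continuous psi -> (forall w, `|psi w| <= 1) ->
  \int[mu]_x (bker a x * \int[mu]_w (gker (a + 2^-1) w * psi (w - softplus x)))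
  = gam 2^-1 * \int[mu]_w (gker a w * psi w).
Proof.
move=> a0 cpsi psi1.
transitivity (\int[mu]_x \int[mu]_w betaf a psi (x, w)).
  by apply: eq_Rintegral => x _; exact: (esym (Rintegral_betaf1 x a0 cpsi psi1)).
have fi := rintegrable_betaf a0 cpsi psi1.
rewrite (@Rintegral12_prod _ _ _ _ _ mu mu (betaf a psi) fi (fun x => rintegrable_betaf1 x a0 cpsi psi1)).
rewrite -(@Rintegral21_prod _ _ _ _ _ mu mu (betaf a psi) fi (fun w => rintegrable_betaf2 a psi w)).
transitivity (\int[mu]_w (gam 2^-1 * (gker a w * psi w))).
  by apply: eq_Rintegral => w _; rewrite [RHS]mulrC; exact: (Rintegral_betaf2 a psi w).
rewrite RintegralZl//; apply: rintegrable_gkerM => //.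
exact: continuous_measurable_fun.
Qed.

(** For psi = 1 the marginal of [betaf] in x is [bker a] times the positive constant Gamma(a + 1/2),
    and Fubini makes marginals integrable. *)
Lemma rintegrable_bker a : 0 < a -> rintegrable mu (bker a).
Proof.
move=> a0; have a2 : 0 < a + 2^-1 by rewrite addr_gt0.
have c1 : continuous (fun _ : R => 1 : R) by exact: cst_continuous.
have n1 (w : R) : `|(1 : R)| <= 1 by rewrite normr1.
have := @rintegrable_prod12 _ _ _ _ _ mu mu _ (rintegrable_betaf a0 c1 n1)
  (fun x => rintegrable_betaf1 x a0 c1 n1).
move=> /(rintegrableZl (gam (a + 2^-1))^-1); apply: eq_integrable => // x _ /=.
have -> : \int[mu]_w betaf a (fun=> 1) (x, w) = bker a x * gam (a + 2^-1).
  rewrite (Rintegral_betaf1 x a0 c1 n1); congr (_ * _).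
  by apply: eq_Rintegral => w _; rewrite mulr1.
by rewrite mulrCA mulVf ?mulr1// gt_eqF// gam_gt0.
Qed.
End BetaIntegral.

(** * The Mellin-Barnes integral *)

Section MellinBarnesIntegral.
Context (R : realType).
Local Notation mu := (@lebesgue_measure R).
Implicit Types a t l : R.

(** [bcos a t] and [bsin a t] are the real part and minus the imaginary part of B(a + i t, 1/2),
    because [softplus] is - ln r. *)
Definition bcos (a t : R) := \int[mu]_x (bker a x * cos (t * softplus x)).
Definition bsin (a t : R) := \int[mu]_x (bker a x * sin (t * softplus x)).

Lemma rintegrable_bkerM a (psi : R -> R) : 0 < a -> continuous psi ->
  (forall x, `|psi x| <= 1) -> rintegrable mu (fun x => bker a x * psi x).
Proof.
move=> a0 cpsi psi1; apply: (rintegrable_le _ _ (rintegrable_bker a0)).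
  apply: continuous_measurable_fun; apply: continuous_mul => //.
  exact: continuous_bker.
by move=> x; rewrite normrM (ger0_norm (bker_ge0 _ _)) ler_piMr ?bker_ge0.
Qed.

Lemma rintegrable_bker_cos a t : 0 < a ->
  rintegrable mu (fun x => bker a x * cos (t * softplus x)).
Proof.
move=> a0; apply: rintegrable_bkerM => // [|x]; last exact: cos_max.
exact: (continuous_fcomp (continuous_fcomp (@continuous_softplus R) (@continuous_scale R t)) (@continuous_cos R)).
Qed.

Lemma rintegrable_bker_sin a t : 0 < a ->
  rintegrable mu (fun x => bker a x * sin (t * softplus x)).
Proof.
move=> a0; apply: rintegrable_bkerM => // [|x]; last exact: sin_max.
exact: (continuous_fcomp (continuous_fcomp (@continuous_softplus R) (@continuous_scale R t)) (@continuous_sin R)).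
Qed.

Lemma bcos_bsin_gcos a t : 0 < a ->
  gcos (a + 2^-1) t * bcos a t + gsin (a + 2^-1) t * bsin a t = gam 2^-1 * gcos a t.
Proof.
move=> a0; have a2 : 0 < a + 2^-1 by rewrite addr_gt0.
have ct : continuous (fun w => cos (t * w)).
  exact: (continuous_fcomp (@continuous_scale R t) (@continuous_cos R)).
rewrite -(bker_conv a0 ct (fun w => cos_max (t * w))).
rewrite -!RintegralZl//; [|exact: rintegrable_bker_sin|exact: rintegrable_bker_cos].
rewrite -RintegralD//; last 2 first.
- exact: rintegrableZl (rintegrable_bker_cos t a0).
- exact: rintegrableZl (rintegrable_bker_sin t a0).
by apply: eq_Rintegral => x _; rewrite Rintegral_gker_cosB//; ring.
Qed.

Lemma Rintegral_gker_sinB a t l : 0 < a ->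
  \int[mu]_w (gker a w * sin (t * (w - l))) = gsin a t * cos (t * l) - gcos a t * sin (t * l).
Proof.
move=> a0; have ic := rintegrable_gker_cos t a0; have is_ := rintegrable_gker_sin t a0.
rewrite ![_ * cos (t * l)]mulrC ![_ * sin (t * l)]mulrC.
rewrite -!RintegralZl// -RintegralB//; [|exact: rintegrableZl..].
by apply: eq_Rintegral => w _; rewrite mulrBr sinB; ring.
Qed.

Lemma bcos_bsin_gsin a t : 0 < a ->
  gsin (a + 2^-1) t * bcos a t - gcos (a + 2^-1) t * bsin a t = gam 2^-1 * gsin a t.
Proof.
move=> a0; have a2 : 0 < a + 2^-1 by rewrite addr_gt0.
have ct : continuous (fun w => sin (t * w)).
  exact: (continuous_fcomp (@continuous_scale R t) (@continuous_sin R)).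
rewrite -(bker_conv a0 ct (fun w => sin_max (t * w))).
rewrite -!RintegralZl//; [|exact: rintegrable_bker_sin|exact: rintegrable_bker_cos].
rewrite -RintegralB//; last 2 first.
- exact: rintegrableZl (rintegrable_bker_cos t a0).
- exact: rintegrableZl (rintegrable_bker_sin t a0).
by apply: eq_Rintegral => x _; rewrite Rintegral_gker_sinB//; ring.
Qed.

(** With l = ln y, p.1 = ln u and r = 1 / (1 + e^(p.2)), this is ln (y / (u r)): the argument left
    to the third kernel in a multiplicative convolution. *)
Definition shift_arg (l : R) (p : R * R) : R := l - p.1 + softplus p.2.

Lemma measurable_shift_arg l : measurable_fun setT (shift_arg l).
Proof.
apply: measurable_funD; first exact: measurable_funB.
apply: measurableT_comp => //; exact: continuous_measurable_fun (@continuous_softplus R).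
Qed.

Lemma rintegrable_gker_bker (b d : R) : 0 < b -> 0 < d ->
  rintegrable (mu \x mu)%E (fun p => gker b p.1 * bker d p.2).
Proof.
by move=> b0 d0; apply: (@rintegrable_prodM _ _ _ _ _ mu mu);
  [exact: rintegrable_gker|exact: rintegrable_bker].
Qed.

Lemma rintegrable_gker_bkerM (b d : R) (f : R * R -> R) : 0 < b -> 0 < d ->
  measurable_fun setT f -> (forall p, `|f p| <= 1) ->
  rintegrable (mu \x mu)%E (fun p => gker b p.1 * bker d p.2 * f p).
Proof.
move=> b0 d0 mf f1; have i0 := rintegrable_gker_bker b0 d0.
have mi := rintegrable_measurable i0.
apply: (rintegrable_le _ _ i0); first exact: (measurable_funM mi mf).
move=> p; have k0 := mulr_ge0 (gker_ge0 b p.1) (bker_ge0 d p.2).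
by rewrite normrM (ger0_norm k0); exact: ler_piMr.
Qed.

Lemma measurable_cos_shift_arg t l : measurable_fun setT (fun p => cos (t * shift_arg l p)).
Proof.
apply: (measurableT_comp (@measurable_cosZ R t)); exact: measurable_shift_arg.
Qed.

Lemma measurable_sin_shift_arg t l : measurable_fun setT (fun p => sin (t * shift_arg l p)).
Proof.
apply: (measurableT_comp (@measurable_sinZ R t)); exact: measurable_shift_arg.
Qed.

(** The exponential of i t times [shift_arg] splits as a product over the two variables. P1 + i P2
    is the product of the transforms, Gamma(b - i t) and B(d - i t, 1/2), and l contributes the
    rotation e^(i t l). *)
Lemma Rintegral_trig_shift_arg (b d t l : R) : 0 < b -> 0 < d ->
  let P1 := gcos b t * bcos d t + gsin b t * bsin d t in
  let P2 := gcos b t * bsin d t - gsin b t * bcos d t in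
  \int[(mu \x mu)%E]_p (gker b p.1 * bker d p.2 * cos (t * shift_arg l p)) =
    P1 * cos (t * l) - P2 * sin (t * l) /\
  \int[(mu \x mu)%E]_p (gker b p.1 * bker d p.2 * sin (t * shift_arg l p)) =
    P1 * sin (t * l) + P2 * cos (t * l).
Proof.
move=> b0 d0 P1 P2.
have gc := rintegrable_gker_cos t b0; have gs := rintegrable_gker_sin t b0.
have bc := rintegrable_bker_cos t d0; have bs := rintegrable_bker_sin t d0.
pose fcc (p : R * R) := gker b p.1 * cos (t * p.1) * (bker d p.2 * cos (t * softplus p.2)).
pose fcs (p : R * R) := gker b p.1 * cos (t * p.1) * (bker d p.2 * sin (t * softplus p.2)).
pose fsc (p : R * R) := gker b p.1 * sin (t * p.1) * (bker d p.2 * cos (t * softplus p.2)).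
pose fss (p : R * R) := gker b p.1 * sin (t * p.1) * (bker d p.2 * sin (t * softplus p.2)).
have icc : rintegrable (mu \x mu)%E fcc := @rintegrable_prodM _ _ _ _ _ mu mu _ _ gc bc.
have ics : rintegrable (mu \x mu)%E fcs := @rintegrable_prodM _ _ _ _ _ mu mu _ _ gc bs.
have isc : rintegrable (mu \x mu)%E fsc := @rintegrable_prodM _ _ _ _ _ mu mu _ _ gs bc.
have iss : rintegrable (mu \x mu)%E fss := @rintegrable_prodM _ _ _ _ _ mu mu _ _ gs bs.
have ecc : \int[(mu \x mu)%E]_p fcc p = gcos b t * bcos d t :=
  @Rintegral_prodM _ _ _ _ _ mu mu _ _ gc bc.
have ecs : \int[(mu \x mu)%E]_p fcs p = gcos b t * bsin d t :=
  @Rintegral_prodM _ _ _ _ _ mu mu _ _ gc bs.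
have esc : \int[(mu \x mu)%E]_p fsc p = gsin b t * bcos d t :=
  @Rintegral_prodM _ _ _ _ _ mu mu _ _ gs bc.
have ess : \int[(mu \x mu)%E]_p fss p = gsin b t * bsin d t :=
  @Rintegral_prodM _ _ _ _ _ mu mu _ _ gs bs.
pose f1 p := fcc p + fss p; pose f2 p := fcs p - fsc p.
have i1 : rintegrable (mu \x mu)%E f1 := rintegrableD icc iss.
have i2 : rintegrable (mu \x mu)%E f2 := rintegrableB ics isc.
have e1 : \int[(mu \x mu)%E]_p f1 p = P1.
  by rewrite (RintegralD measurableT icc iss) ecc ess.
have e2 : \int[(mu \x mu)%E]_p f2 p = P2.
  by rewrite (RintegralB measurableT ics isc) ecs esc.
have hl (x y : R) : \int[(mu \x mu)%E]_p (x * f1 p + y * f2 p) = x * P1 + y * P2.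
  rewrite (RintegralD measurableT (rintegrableZl x i1) (rintegrableZl y i2)).
  by rewrite (RintegralZl _ measurableT i1) (RintegralZl _ measurableT i2) e1 e2.
split.
  transitivity (cos (t * l) * P1 + - sin (t * l) * P2); last by ring.
  rewrite -hl; apply: eq_Rintegral => p _.
  by rewrite /shift_arg mulrDr mulrBr cosD cosB sinB /f1 /f2 /fcc /fcs /fsc /fss; ring.
transitivity (sin (t * l) * P1 + cos (t * l) * P2); last by ring.
rewrite -hl; apply: eq_Rintegral => p _.
by rewrite /shift_arg mulrDr mulrBr sinD cosB sinB /f1 /f2 /fcc /fcs /fsc /fss; ring.
Qed.

(** The last factor is the real part of Gamma(a - i t) e^(i t shift). Integrated over p it gives the
    real part of the contour integrand, up to constants and y^sigma; integrated over t it is a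
    Cahen-Mellin integral. *)
Definition mbker (a b d l : R) (z : R * (R * R)) : R := gker b z.2.1 * bker d z.2.2 *
  (gcos a z.1 * cos (z.1 * shift_arg l z.2) + gsin a z.1 * sin (z.1 * shift_arg l z.2)).

Section MellinBarnes.
Context (a b d l : R) (a0 : 0 < a) (b0 : 0 < b) (d0 : 0 < d).

Lemma measurable_mbker : measurable_fun setT (mbker a b d l).
Proof.
have i0 := rintegrable_measurable (rintegrable_gker_bker b0 d0).
have mg := measurable_gcos a0; have ms := measurable_gsin a0.
have msh := measurable_shift_arg l.
have mts : measurable_fun setT (fun z : R * (R * R) => z.1 * shift_arg l z.2).
  by apply: measurable_funM => //; exact: measurableT_comp.
apply: measurable_funM.
  exact: (measurableT_comp i0 (@measurable_snd _ _ R (R * R)%type)).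
apply: measurable_funD; apply: measurable_funM.
- exact: (measurableT_comp mg (@measurable_fst _ _ R (R * R)%type)).
- exact: (measurableT_comp (continuous_measurable_fun (@continuous_cos R)) mts).
- exact: (measurableT_comp ms (@measurable_fst _ _ R (R * R)%type)).
- exact: (measurableT_comp (continuous_measurable_fun (@continuous_sin R)) mts).
Qed.

Lemma mbker_le t p : `|mbker a b d l (t, p)| <=
  2 * gbound a * (1 + t ^+ 2)^-1 * (gker b p.1 * bker d p.2).
Proof.
have k0 := mulr_ge0 (gker_ge0 b p.1) (bker_ge0 d p.2).
rewrite /mbker/= normrM (ger0_norm k0) mulrC; apply: ler_wpM2r => //.
rewrite -mulrA mulr_natl mulr2n (le_trans (ler_normD _ _))// !normrM.
by apply: lerD; [apply: le_trans (gcos_decay t a0)|apply: le_trans (gsin_decay t a0)];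
  rewrite ler_piMr ?normr_ge0 ?cos_max ?sin_max.
Qed.

Lemma rintegrable_mbker1 t : rintegrable (mu \x mu)%E (fun p => mbker a b d l (t, p)).
Proof.
apply: (rintegrable_le _ _ (rintegrableZl (2 * gbound a * (1 + t ^+ 2)^-1)
  (rintegrable_gker_bker b0 d0))); last exact: mbker_le.
exact: (measurableT_comp measurable_mbker (measurable_pair1 t)).
Qed.

Lemma rintegrable_mbker2 p : rintegrable mu (fun t => mbker a b d l (t, p)).
Proof.
exact: (rintegrableZl (gker b p.1 * bker d p.2) (rintegrable_gcos_gsin (shift_arg l p) a0)).
Qed.

(** Fubini applies because [mbker] is dominated by a multiple of 1 / (1 + t^2) times an integrable
    function of p; for fixed p the integral over t is evaluated by [Cahen_Mellin]. *)
Lemma Rintegral_mbker : \int[mu]_t \int[(mu \x mu)%E]_p mbker a b d l (t, p) =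
  2 * pi * \int[(mu \x mu)%E]_p (gker b p.1 * bker d p.2 * gker a (shift_arg l p)).
Proof.
pose A t := 2 * gbound a * (1 + t ^+ 2)^-1.
have iA : rintegrable mu A := rintegrableZl (2 * gbound a) (rintegrable_cauchy R).
have fi := @rintegrable_prod_le _ _ _ _ _ mu (sigma_finite_prod mu mu) (mbker a b d l) A _
  measurable_mbker mbker_le iA (rintegrable_gker_bker b0 d0).
rewrite (@Rintegral12_prod _ _ _ _ _ mu (sigma_finite_prod mu mu) (mbker a b d l) fi rintegrable_mbker1).
rewrite -(@Rintegral21_prod _ _ _ _ _ mu (sigma_finite_prod mu mu) (mbker a b d l) fi rintegrable_mbker2).
rewrite -RintegralZl//; last first.
  (* [rintegrable_gker_bkerM] takes a factor bounded by 1, so [gker a] is divided by its bound exp(2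
     a^2). *)
  have mga : measurable_fun setT (fun p => (expR (2 * a ^+ 2))^-1 * gker a (shift_arg l p)).
    apply: measurable_funM => //; apply: measurableT_comp (measurable_shift_arg l).
    exact: continuous_measurable_fun (@continuous_gker R a).
  have := rintegrable_gker_bkerM b0 d0 mga.
  move=> /(_ _)/(rintegrableZl (expR (2 * a ^+ 2))) h.
  rewrite (_ : _ \o _ = EFin \o (fun p => expR (2 * a ^+ 2) * (gker b p.1 * bker d p.2 *
    ((expR (2 * a ^+ 2))^-1 * gker a (shift_arg l p))))).
    apply: h => p; rewrite ger0_norm ?mulr_ge0 ?gker_ge0// ?invr_ge0 ?expR_ge0//.
    by rewrite mulrC ler_pdivrMr ?expR_gt0// mul1r gker_bound.
  apply/funext => p /=; congr EFin; rewrite mulrCA; congr (_ * _).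
  by rewrite mulrA mulfV ?mul1r// gt_eqF// expR_gt0.
apply: eq_Rintegral => p _.
rewrite /mbker/= RintegralZl//; last exact: rintegrable_gcos_gsin.
by rewrite Cahen_Mellin//; ring.
Qed.

Lemma Rintegral_mbker1 t (P1 := gcos b t * bcos d t + gsin b t * bsin d t)
    (P2 := gcos b t * bsin d t - gsin b t * bcos d t) :
  \int[(mu \x mu)%E]_p mbker a b d l (t, p) =
    gcos a t * (P1 * cos (t * l) - P2 * sin (t * l)) +
    gsin a t * (P1 * sin (t * l) + P2 * cos (t * l)).
Proof.
have [<- <-] := Rintegral_trig_shift_arg t l b0 d0.
have ic := rintegrable_gker_bkerM b0 d0 (measurable_cos_shift_arg t l) (fun=> cos_max _).
have is_ := rintegrable_gker_bkerM b0 d0 (measurable_sin_shift_arg t l) (fun=> sin_max _).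
rewrite -!RintegralZl// -RintegralD//; [|exact: rintegrableZl ic|exact: rintegrableZl is_].
by apply: eq_Rintegral => p _; rewrite /mbker/=; ring.
Qed.

End MellinBarnes.
End MellinBarnesIntegral.

(** * The Meijer function as an integral of positive kernels *)

Section MeijerFunction.
Context (R : realType).
Local Notation mu := (@lebesgue_measure R).
Implicit Types a t l : R.

(** The substitution u = e^w on [e^(-n), e^n], followed by monotone convergence on both sides. *)
Lemma ge0_integral_expR_subst (G : R -> R) :
  (forall u, 0 < u -> {for u, continuous G}) -> (forall u, 0 < u -> 0 <= G u) ->
  (\int[mu]_(u in `]0%R, +oo[) (G u)%:E = \int[mu]_w (G (expR w) * expR w)%:E)%E.
Proof.
move=> cG G0.
pose A n : set R := `[expR (- n%:R), expR n%:R]%classic.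
pose B n : set R := `[- n%:R, n%:R]%classic.
have UA : \bigcup_n A n = `]0, +oo[%classic.
  apply/seteqP; split=> [u [n _]|u]; rewrite /A/= !in_itv/= ?andbT.
    by move=> /andP[/(lt_le_trans (expR_gt0 _))].
  move=> u0; exists (Num.truncn `|ln u|).+1 => //=.
  rewrite in_itv/= -[X in _ <= X <= _]lnK ?posrE// !ler_expR -ler_norml.
  by rewrite ltW// truncnS_gt.
have UB : \bigcup_n B n = setT.
  apply/seteqP; split=> // w _; exists (Num.truncn `|w|).+1 => //=.
  by rewrite /B/= in_itv/= -ler_norml ltW// truncnS_gt.
have ndA : nondecreasing_seq A.
  move=> m n mn; rewrite subsetEset => u; rewrite /A/= !in_itv/= => /andP[h1 h2].
  by rewrite (le_trans _ h1) ?(le_trans h2)// ler_expR ?lerN2 ler_nat.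
have ndB : nondecreasing_seq B.
  move=> m n mn; rewrite subsetEset => u; rewrite /B/= !in_itv/= => /andP[h1 h2].
  by rewrite (le_trans _ h1) ?(le_trans h2)// ?lerN2 ler_nat.
have cGe : continuous (fun w => G (expR w) * expR w).
  apply: continuous_mul; last exact: continuous_expR.
  by move=> w; apply: continuous_comp; [exact: continuous_expR|apply: cG; exact: expR_gt0].
have A0 n u : A n u -> 0 < u.
  by rewrite /A/= in_itv/= => /andP[/(lt_le_trans (expR_gt0 _))].
have mG : measurable_fun (`]0, +oo[ : set R) (fun u => (G u)%:E).
  apply/measurable_EFinP; apply: open_continuous_measurable_fun.
    exact: interval_open.
  by move=> u; rewrite inE/= in_itv/= andbT; exact: cG.
have hA : (\int[mu]_(u in A n) (G u)%:E @[n --> \oo] --> \int[mu]_(u in `]0%R, +oo[) (G u)%:E)%E.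
  rewrite -UA; apply: ge0_nondecreasing_set_cvg_integral => //.
  - by move=> n; exact: measurable_itv.
  - move=> n; apply: measurable_funS mG => //.
    by move=> u /A0; rewrite /= in_itv/= andbT.
  - by move=> n u /A0 u0; rewrite lee_fin G0.
have hB : (\int[mu]_(w in B n) (G (expR w) * expR w)%:E @[n --> \oo] -->
    \int[mu]_w (G (expR w) * expR w)%:E)%E.
  rewrite -UB; apply: ge0_nondecreasing_set_cvg_integral => //.
  - by move=> n; exact: measurable_itv.
  - by move=> n; apply/measurable_EFinP/measurable_funTS; exact: continuous_measurable_fun.
  - by move=> n w _; rewrite lee_fin mulr_ge0 ?expR_ge0// G0// expR_gt0.
have dexp : (@expR R)^`()%classic = expR.
  by apply/funext => w; rewrite derive1E derive_val.
have hAB n : (\int[mu]_(u in A n) (G u)%:E = \int[mu]_(w in B n) (G (expR w) * expR w)%:E)%E.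
  rewrite /A /B (@integration_by_substitution_increasing R expR G (- n%:R) n%:R).
  - by apply: eq_integral => w _; rewrite dexp.
  - by rewrite (@le_trans _ _ 0) ?oppr_le0.
  - by move=> x y _ _; rewrite ltr_expR.
  - by rewrite dexp => w _; exact: continuous_expR.
  - by rewrite dexp; apply: (cvgP (expR (- n%:R))); apply: cvg_at_right_filter; exact: continuous_expR.
  - by rewrite dexp; apply: (cvgP (expR n%:R)); apply: cvg_at_left_filter; exact: continuous_expR.
  - split=> [w _||]; first by [].
      by apply: cvg_at_right_filter; exact: continuous_expR.
    by apply: cvg_at_left_filter; exact: continuous_expR.
  - apply: continuous_in_subspaceT => u /set_mem.
    by move=> /(A0 n) u0; exact: cG.
apply: (cvg_unique (@ereal_hausdorff R) hA).
by rewrite (funext hAB : (fun n => \int[mu]_(u in A n) (G u)%:E)%E = _).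
Qed.

Lemma Rintegral_expR_subst (G : R -> R) : (forall u, 0 < u -> {for u, continuous G}) ->
  \int[mu]_(u in `]0%R, +oo[) G u = \int[mu]_w (G (expR w) * expR w).
Proof.
move=> cG; rewrite /Rintegral; congr fine.
rewrite [in LHS]integralE [in RHS]integralE; congr (_ - _)%E.
  transitivity (\int[mu]_(u in `]0%R, +oo[) (Num.max (G u) 0)%:E)%E.
    by apply: eq_integral => u _; rewrite funeposE EFin_max.
  rewrite ge0_integral_expR_subst; last 2 first.
  - by move=> u u0; apply: continuous_max; [exact: cG|exact: cst_continuous].
  - by move=> u _; rewrite le_max lexx orbT.
  apply: eq_integral => w _; rewrite funeposE -EFin_max; congr EFin.
  by rewrite maxr_pMl ?expR_ge0// mul0r.
transitivity (\int[mu]_(u in `]0%R, +oo[) (Num.max (- G u) 0)%:E)%E.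
  by apply: eq_integral => u _; rewrite funenegE EFin_max.
rewrite ge0_integral_expR_subst; last 2 first.
- by move=> u u0; apply: continuous_max; [apply: continuousN; exact: cG|exact: cst_continuous].
- by move=> u _; rewrite le_max lexx orbT.
apply: eq_integral => w _; rewrite funenegE -EFin_max; congr EFin.
by rewrite maxr_pMl ?expR_ge0// mul0r mulNr.
Qed.

Lemma continuous_pos_ln_comp (f : R -> R) : continuous f ->
  forall u, 0 < u -> {for u, continuous (fun u => f (ln u))}.
Proof. by move=> cf u u0; apply: continuous_comp; [exact: continuous_ln|exact: cf]. Qed.

Lemma Rintegral_expR_subst_gker a (psi : R -> R) : continuous psi ->
  \int[mu]_(u in `]0%R, +oo[) (expR ((a - 1) * ln u) * psi (ln u) * expR (- u)) =
  \int[mu]_w (gker a w * psi w).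
Proof.
move=> cpsi; rewrite Rintegral_expR_subst.
  apply: eq_Rintegral => w _; rewrite expRK /gker mulrAC -!mulrA mulrC -!mulrA -!expRD.
  by rewrite mulrC; congr (expR _ * _); ring.
move=> u u0; apply: continuousM.
  apply: (@continuous_pos_ln_comp (fun x => expR ((a - 1) * x) * psi x)) => //.
  apply: continuous_mul => //.
  exact: (continuous_fcomp (@continuous_scale R (a - 1)) (@continuous_expR R)).
by apply: continuous_comp; [exact: opp_continuous|exact: continuous_expR].
Qed.

Local Open Scope complex_scope.

(** For positive real part the shift in the definition of [Gamma] is 0, since 1 - a < 1 truncates to
    0; what remains is Euler's integral, with u = e^w. *)
Lemma Gamma_gcos_gsin a t : 0 < a -> Gamma (a +i* t) = gcos a t +i* gsin a t.
Proof.
move=> a0; rewrite /Gamma /=.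
have -> : Num.truncn (1 - a) = 0%N.
  by apply/truncn0Pn; rewrite -ltNge ltrBlDr ltrDl.
rewrite big_ord0 divr1 addr0 /euler_gamma /cintegral.
congr (_ +i* _).
  rewrite /gcos -(Rintegral_expR_subst_gker a (psi := fun w => cos (t * w))); last first.
    exact: (continuous_fcomp (@continuous_scale R t) (@continuous_cos R)).
  apply: eq_Rintegral => u _ /=.
  by rewrite !(mulr0, subr0, oppr0, addr0, add0r).
rewrite /gsin -(Rintegral_expR_subst_gker a (psi := fun w => sin (t * w))); last first.
  exact: (continuous_fcomp (@continuous_scale R t) (@continuous_sin R)).
apply: eq_Rintegral => u _ /=.
by rewrite !(mulr0, subr0, oppr0, addr0, add0r).
Qed.

Lemma gcosN a t : gcos a (- t) = gcos a t.
Proof. by apply: eq_Rintegral => w _; rewrite mulNr cosN. Qed.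

Lemma gsinN a t : 0 < a -> gsin a (- t) = - gsin a t.
Proof.
move=> a0; rewrite -[RHS]mulN1r [in RHS]/gsin.
rewrite -(RintegralZl (-1) measurableT (rintegrable_gker_sin t a0)).
by apply: eq_Rintegral => w _; rewrite mulNr sinN; ring.
Qed.

Lemma Gamma_real a : 0 < a -> Gamma a%:C = (gam a)%:C.
Proof. by move=> a0; rewrite Gamma_gcos_gsin// gcos0 gsin0. Qed.

Lemma Gamma_line (b sigma t : R) : sigma < b ->
  Gamma (b%:C - (sigma +i* t)) = gcos (b - sigma) t -i* gsin (b - sigma) t.
Proof.
move=> sb; rewrite (_ : b%:C - _ = (b - sigma) +i* (- t)).
  by rewrite Gamma_gcos_gsin ?subr_gt0// gcosN gsinN ?subr_gt0.
by apply/eqP; rewrite eq_complex /= sub0r !eqxx.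
Qed.

(** The identities [bcos_bsin_gcos] and [bcos_bsin_gsin], conjugated because s has imaginary part t;
    the division is legitimate by [gcos_gsin_gt0]. *)
Lemma Gamma_ratio (w sigma t : R) : sigma < w ->
  Gamma (w%:C - (sigma +i* t)) / Gamma ((w + 2^-1)%:C - (sigma +i* t)) =
  (gam 2^-1)^-1%:C * (bcos (w - sigma) t +i* bsin (w - sigma) t).
Proof.
move=> sw; have d0 : 0 < w - sigma by rewrite subr_gt0.
have d2 : 0 < w - sigma + 2^-1 by rewrite addr_gt0.
have g0 : gam 2^-1 != 0 :> R by rewrite gt_eqF// gam_gt0.
rewrite !Gamma_line//; last by rewrite (lt_trans sw)// ltrDl.
rewrite addrAC.
have hc := bcos_bsin_gcos t d0; have hs := bcos_bsin_gsin t d0.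
have n0 := gcos_gsin_gt0 t d2.
have Y0 : gcos (w - sigma + 2^-1) t -i* gsin (w - sigma + 2^-1) t != 0.
  rewrite eq_complex /= oppr_eq0; apply/negP => /andP[/eqP c0 /eqP s0].
  by move: n0; rewrite c0 s0 expr0n/= addr0 ltxx.
apply: (mulIf Y0); rewrite divfK//; apply/eqP; rewrite eq_complex /=.
apply/andP; split; apply/eqP; apply: (mulfI g0).
  by rewrite -hc; field.
by rewrite mulrN -hs; field.
Qed.

Lemma rintegrable_mbker_int (a b d l : R) : 0 < a -> 0 < b -> 0 < d ->
  rintegrable mu (fun t => \int[(mu \x mu)%E]_p mbker a b d l (t, p)).
Proof.
move=> a0 b0 d0; pose A t := 2 * gbound a * (1 + t ^+ 2)^-1.
have iA : rintegrable mu A := rintegrableZl (2 * gbound a) (rintegrable_cauchy R).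
have fi := @rintegrable_prod_le _ _ _ _ _ mu (sigma_finite_prod mu mu) (mbker a b d l) A _
  (measurable_mbker l a0 b0 d0) (mbker_le b d l a0) iA (rintegrable_gker_bker b0 d0).
exact: (@rintegrable_prod12 _ _ _ _ _ mu (sigma_finite_prod mu mu) (mbker a b d l) fi
  (rintegrable_mbker1 l a0 b0 d0)).
Qed.

Lemma Re_meijerG (sigma w al be y : R) : sigma < al -> sigma < be -> sigma < w -> 0 < y ->
  complex.Re (meijerG3013 sigma (w + 2^-1) al be w y) =
  (gam 2^-1)^-1 * expR (sigma * ln y) *
  \int[(mu \x mu)%E]_p (gker (be - sigma) p.1 * bker (w - sigma) p.2 *
    gker (al - sigma) (shift_arg (ln y) p)).
Proof.
move=> sa sb sw y0; set l := ln y; set D := \int[_]_p _.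
have a0 : 0 < al - sigma by rewrite subr_gt0.
have b0 : 0 < be - sigma by rewrite subr_gt0.
have d0 : 0 < w - sigma by rewrite subr_gt0.
have pi0 : 2 * pi != 0 :> R by rewrite mulf_neq0// gt_eqF// pi_gt0.
rewrite /meijerG3013 /cintegral.
have -> : ((2 * pi)%:C * 'i)^-1 = 0 -i* (2 * pi)^-1 :> R[i].
  apply: (@mulIf _ ((2 * pi)%:C * 'i)); first by rewrite eq_complex /= !(mulr0, mul0r, mulr1, subr0, add0r, addr0) negb_and pi0 orbT.
  rewrite mulVf; last by rewrite eq_complex /= !(mulr0, mul0r, mulr1, subr0, add0r, addr0) negb_and pi0 orbT.
  apply/eqP; rewrite eq_complex /=.
  rewrite !(mulr0, mul0r, mulr1, oppr0, subr0, add0r, addr0, sub0r) mulNr opprK mulVf//.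
  by rewrite !eqxx.
set X := \int[_]_t complex.Re _; set Y := \int[_]_t complex.Im _.
(* The integrand carries the factor i of ds, so the real part of G is read off the imaginary part of
   the complex integral. *)
have -> : complex.Re ((0 -i* (2 * pi)^-1) * (X +i* Y)) = (2 * pi)^-1 * Y.
  by rewrite /= mul0r sub0r mulNr opprK.
rewrite {X}/Y.
pose K := (gam 2^-1)^-1 * expR (sigma * l).
transitivity ((2 * pi)^-1 * \int[mu]_t (K * \int[(mu \x mu)%E]_p
    mbker (al - sigma) (be - sigma) (w - sigma) l (t, p))).
  congr (_ * _); apply: eq_Rintegral => t _.
  rewrite Rintegral_mbker1// -[_ * _ * _ / _]mulrA Gamma_ratio// !Gamma_line//.
  rewrite /K /= -/l !(mulr0, subr0, add0r, mulr1, addr0); ring.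
rewrite (RintegralZl _ measurableT (rintegrable_mbker_int l a0 b0 d0)).
by rewrite Rintegral_mbker// -/D mulrCA mulKf.
Qed.
End MeijerFunction.

(** * Small-argument bounds *)

Section MeijerBounds.
Context (R : realType).
Local Notation mu := (@lebesgue_measure R).
Implicit Types a t l : R.

(** The plane integral at abscissa 0 in the variable l = ln y; the Meijer function is this up to the
    constant 1 / Gamma(1/2). *)
Definition foxG (al be w : R) (l : R) : R :=
  \int[(mu \x mu)%E]_p (gker be p.1 * bker w p.2 * gker al (shift_arg l p)).

(** The tilts by sigma of the three kernels cancel against e^(sigma l), pointwise. This replaces the
    shift of contour and shows that sigma does not affect the value. *)
Lemma foxG_ker_shift sigma al be w l (p : R * R) :
  expR (sigma * l) * (gker (be - sigma) p.1 * bker (w - sigma) p.2 *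
    gker (al - sigma) (shift_arg l p)) =
  gker be p.1 * bker w p.2 * gker al (shift_arg l p).
Proof. by rewrite /gker /bker /shift_arg -!expRD; congr expR; ring. Qed.

Lemma gker_le_exp a q x : q < a -> gker a x <= expR (2 * (a - q) ^+ 2) * expR (q * x).
Proof.
move=> qa; have := @gker_bound R (a - q) x; rewrite subr_gt0 => /(_ qa) h.
have -> : gker a x = gker (a - q) x * expR (q * x).
  by rewrite /gker -expRD; congr expR; ring.
by rewrite ler_wpM2r ?expR_ge0.
Qed.

Section FoxG.
Context (al be w : R) (al0 : 0 < al) (be0 : 0 < be) (w0 : 0 < w).

Lemma foxG_ker_ge0 l p : 0 <= gker be p.1 * bker w p.2 * gker al (shift_arg l p).
Proof.
exact: mulr_ge0 (mulr_ge0 (gker_ge0 _ _) (bker_ge0 _ _)) (gker_ge0 _ _).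
Qed.

Lemma foxG_ker_le q l p : q < al ->
  gker be p.1 * bker w p.2 * gker al (shift_arg l p) <=
  expR (2 * (al - q) ^+ 2) * expR (q * l) * (gker (be - q) p.1 * bker (w - q) p.2).
Proof.
move=> qa; have h := gker_le_exp (shift_arg l p) qa.
have k0 := mulr_ge0 (gker_ge0 be p.1) (bker_ge0 w p.2).
apply: (le_trans (ler_wpM2l k0 h)).
rewrite [leLHS]mulrCA -[leRHS]mulrA ler_wpM2l ?expR_ge0//.
by rewrite /gker /bker /shift_arg -!expRD ler_expR le_eqVlt; apply/orP; left; apply/eqP; ring.
Qed.

Lemma measurable_foxG_ker l : measurable_fun setT
  (fun p => gker be p.1 * bker w p.2 * gker al (shift_arg l p)).
Proof.
have mb := rintegrable_measurable (rintegrable_gker_bker be0 w0).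
apply: (measurable_funM mb); apply: measurableT_comp (measurable_shift_arg l).
exact: continuous_measurable_fun (@continuous_gker R al).
Qed.

Lemma rintegrable_foxG_ker l : rintegrable (mu \x mu)%E
  (fun p => gker be p.1 * bker w p.2 * gker al (shift_arg l p)).
Proof.
apply: (rintegrable_le _ _
  (rintegrableZl (expR (2 * (al - 0) ^+ 2) * expR (0 * l)) (rintegrable_gker_bker be0 w0))).
  exact: measurable_foxG_ker.
move=> p; rewrite (ger0_norm (foxG_ker_ge0 l p)).
by have := foxG_ker_le l p al0; rewrite !subr0.
Qed.

(** Tilting by q extracts e^(q l): the tilted [gker (al - q)] is bounded since q < al, and the two
    other tilted kernels stay integrable since q < be and q < w. *)
Lemma foxG_le q : q < al -> q < be -> q < w ->
  exists2 C, 0 < C & forall l, foxG al be w l <= C * expR (q * l).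
Proof.
move=> qa qb qw; have b0 : 0 < be - q by rewrite subr_gt0.
have d0 : 0 < w - q by rewrite subr_gt0.
have iB := rintegrable_gker_bker b0 d0.
pose I := \int[(mu \x mu)%E]_p (gker (be - q) p.1 * bker (w - q) p.2).
have I0 : 0 <= I.
  by apply: Rintegral_ge0 => p _; apply: mulr_ge0; [exact: gker_ge0|exact: bker_ge0].
(* I + 1 rather than I, so that the constant is visibly positive. *)
exists (expR (2 * (al - q) ^+ 2) * (I + 1)).
  by rewrite mulr_gt0 ?expR_gt0// ltr_wpDl.
move=> l; apply: (@le_trans _ _ (expR (2 * (al - q) ^+ 2) * expR (q * l) * I)).
  rewrite /I -(RintegralZl _ measurableT iB); apply: le_Rintegral => //.
  - exact: rintegrable_foxG_ker.
  - exact: rintegrableZl.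
  - by move=> p _; exact: foxG_ker_le.
by rewrite mulrAC ler_wpM2r ?expR_ge0// ler_wpM2l ?expR_ge0// lerDl.
Qed.

(* On the unit square with corner (l2, - l3) all three kernels are comparable
   to their values e^(be l2), e^(w l3) and e^(al l1) at the corner. *)
Lemma foxG_ge : exists2 c, 0 < c & forall l1 l2 l3, l1 <= 0 -> l2 <= 0 -> l3 <= 0 ->
  c * expR (al * l1 + be * l2 + w * l3) <= foxG al be w (l1 + l2 + l3).
Proof.
(* On the square v <= 1, so e^v <= e; the first argument of [gker al] lies between l1 - 1 and 2,
   which costs al and e^2; replacing [softplus x] and x by - l3 costs at most 2 (w + 1/2). *)
exists (expR (- expR 1 - (w + 2^-1) * 2 - al - expR 2 - 2)); first exact: expR_gt0.
move=> l1 l2 l3 h1 h2 h3; rewrite -expRD.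
pose A : set (R * R) := (`[l2, l2 + 1] `*` `[- l3, - l3 + 1])%classic.
have muA : (mu \x mu)%E A = 1%:E.
  rewrite product_measure1E; [|exact: measurable_itv|exact: measurable_itv].
  rewrite [in LHS]/= !lebesgue_measure_itv/= !lte_fin !ltrDl ltr01.
  by rewrite -!EFinD -EFinM; congr EFin; ring.
rewrite -[leLHS]mulr1.
apply: (@Rintegral_ge_on _ _ R (mu \x mu)%E A _ _ 1 _ muA
  (rintegrable_foxG_ker (l1 + l2 + l3)) (expR_ge0 _) (foxG_ker_ge0 _)).
  by apply: measurableX; exact: measurable_itv.
move=> [v x] [/=]; rewrite !in_itv/= => /andP[v1 v2] /andP[x1 x2].
rewrite /gker /bker /shift_arg/= -!expRD ler_expR.
have s1 : x <= softplus x.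
  by rewrite -ler_expR expR_softplus lerDr.
have s2 : softplus x <= x + 1.
  rewrite -ler_expR expR_softplus expRD.
  have := expR_ge1Dx (1 : R); have e1 : 1 <= expR x by rewrite -expR0 ler_expR; lra.
  nra.
have e1 : expR v <= expR 1 by rewrite ler_expR; lra.
have e2 : expR (l1 + l2 + l3 - v + softplus x) <= expR 2 by rewrite ler_expR; lra.
have w2 : 0 < w + 2^-1 by rewrite addr_gt0.
have p1 : 0 <= be * (v - l2) by rewrite mulr_ge0 ?subr_ge0// ltW.
have p2 : 0 <= (w + 2^-1) * (x + 1 - softplus x) by rewrite mulr_ge0 ?subr_ge0// ltW.
have p3 : 0 <= w * (- l3 + 1 - x) by rewrite mulr_ge0 ?subr_ge0// ltW.
have p4 : 0 <= al * (l2 + l3 - v + softplus x + 1) by rewrite mulr_ge0 ?(ltW al0)//; lra.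
lra.
Qed.
End FoxG.
End MeijerBounds.

(** * The density and iterated integrals of products *)

Section SnrDensity.
Context (R : realType).
Local Notation mu := (@lebesgue_measure R).
Implicit Types a t l : R.

Lemma Re_real_mulc (r : R) (z : R[i]) : complex.Re (r%:C%C * z) = r * complex.Re z.
Proof. by case: z => a b /=; rewrite mul0r subr0. Qed.

Lemma real_complex_frac (r a b c : R) :
  (r%:C / (a%:C * b%:C * c%:C))%C = (r / (a * b * c))%:C%C.
Proof. by rewrite [RHS]rmorphM [X in _ = _ * X]fmorphV !rmorphM. Qed.

(** The square root in the argument halves ln x - ln gbar; this is the source of the factor 1/2 in
    the diversity order. *)
Lemma snr_density_foxG (sigma al be w A0 hl gbar x : R) :
  0 < al -> 0 < be -> 0 < w -> 0 < A0 -> 0 < hl ->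
  sigma < al -> sigma < be -> sigma < w -> 0 < gbar -> 0 < x ->
  snr_density sigma al be w A0 hl gbar x =
  Num.sqrt w / (2 * gam al * gam be * gam 2^-1) * x^-1 *
    foxG al be w (ln (al * be / (A0 * hl)) + (ln x - ln gbar) / 2).
Proof.
move=> al0 be0 w0 A00 hl0 sa sb sw g0 x0.
have k0 : 0 < al * be / (A0 * hl) by rewrite divr_gt0// mulr_gt0.
have xg0 : 0 < x / gbar by rewrite divr_gt0.
have y0 : 0 < al * be / (A0 * hl) * Num.sqrt (x / gbar).
  by rewrite mulr_gt0// sqrtr_gt0.
have -> : ln (al * be / (A0 * hl)) + (ln x - ln gbar) / 2 =
    ln (al * be / (A0 * hl) * Num.sqrt (x / gbar)).
  rewrite [RHS]lnM ?posrE ?sqrtr_gt0//; congr (_ + _).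
  rewrite -ln_div ?posrE// -[in LHS](sqr_sqrtr (ltW xg0)) lnXn ?sqrtr_gt0//.
  by move: (ln _) => z; field.
set y := _ * Num.sqrt (x / gbar) in y0 *.
rewrite /snr_density -/y !Gamma_real// real_complex_frac.
rewrite Re_real_mulc Re_meijerG//.
have a0 : 0 < al - sigma by rewrite subr_gt0.
have b0 : 0 < be - sigma by rewrite subr_gt0.
have d0 : 0 < w - sigma by rewrite subr_gt0.
have ik := rintegrable_foxG_ker a0 b0 d0 (ln y).
have -> : foxG al be w (ln y) = expR (sigma * ln y) *
  \int[(mu \x mu)%E]_p (gker (be - sigma) p.1 * bker (w - sigma) p.2 *
    gker (al - sigma) (shift_arg (ln y) p)).
  rewrite -(RintegralZl _ measurableT ik) /foxG.
  by apply: eq_Rintegral => p _; rewrite foxG_ker_shift.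
set D := \int[_]_p _; set E := expR _; set r := Num.sqrt w.
have g1 := gam_gt0 al0; have g2 := gam_gt0 be0.
have g3 : 0 < gam 2^-1 :> R by rewrite gam_gt0.
move: (gam al) (gam be) (gam 2^-1) g1 g2 g3 => u v z u0 v0 z0.
by field; rewrite !gt_eqF.
Qed.

(** A nonnegative integral is a supremum over the simple functions below the integrand, and a larger
    integrand admits more of them. Iterated integrals can thus be compared without establishing
    measurability of their slices. *)
Lemma le_ge0_integral d (T : measurableType d) (m : {measure set T -> \bar R})
  (f g : T -> \bar R) : (forall x, 0 <= f x)%E -> (forall x, f x <= g x)%E ->
  (\int[m]_x f x <= \int[m]_x g x)%E.
Proof.
move=> f0 fg; have g0 x : (0 <= g x)%E by exact: le_trans (fg x).
rewrite !ge0_integralTE//; apply: le_ereal_sup => _ [h hf <-].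
by exists h => // x; exact: le_trans (hf x) (fg x).
Qed.

Lemma tuple_integral_ge0 n (F : n.-tuple R -> \bar R) :
  (forall x, 0 <= F x)%E -> (0 <= tuple_integral F)%E.
Proof.
elim: n F => [|n IH] F F0 /=; first exact: F0.
by apply: integral_ge0 => x _; apply: IH => v; exact: F0.
Qed.

Lemma le_tuple_integral n (F G : n.-tuple R -> \bar R) :
  (forall x, 0 <= F x)%E -> (forall x, F x <= G x)%E ->
  (tuple_integral F <= tuple_integral G)%E.
Proof.
elim: n F G => [|n IH] F G F0 FG /=; first exact: FG.
apply: le_ge0_integral => x; last by apply: IH => v; [exact: F0|exact: FG].
by apply: tuple_integral_ge0 => v; exact: F0.
Qed.

(** The scalar k makes the induction work: once the first coordinate is fixed, its factor is
    absorbed into k. *)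
Lemma tuple_integral_prod n (h : R -> R) (k : R) : rintegrable mu h ->
  tuple_integral (fun x : n.-tuple R => (k * \prod_(m < n) h (tnth x m))%:E) =
  (k * (\int[mu]_x h x) ^+ n)%:E.
Proof.
move=> hi; elim: n k => [|n IH] k /=; first by rewrite big_ord0.
transitivity (\int[mu]_x ((k * (\int[mu]_x h x) ^+ n) * h x)%:E)%E.
  apply: eq_integral => x _.
  rewrite [RHS](_ : _ = ((k * h x) * (\int[mu]_x h x) ^+ n)%:E); last by congr EFin; ring.
  rewrite -IH; congr tuple_integral; apply/funext => v; congr EFin.
  rewrite big_ord_recl tnth0 mulrA; congr (_ * _).
  by apply: eq_bigr => i _; rewrite tnthS.
rewrite -EFin_Rintegral; last exact: rintegrableZl.
by rewrite (RintegralZl _ measurableT hi) exprS; congr EFin; ring.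
Qed.
End SnrDensity.

Section SnrDensityBounds.
Context (R : realType).
Local Notation mu := (@lebesgue_measure R).
Implicit Types a t l : R.

(** The density x^(q-1) e^(-x) of Gamma(q), extended by 0. On a bounded interval ]0, K[ it dominates
    x^(q-1) up to e^K, and its integrability reduces to that of [gker q]. *)
Definition powexp (q x : R) : R :=
  if 0 < x then expR ((q - 1) * ln x) * expR (- x) else 0.

Lemma rintegrable_powexp q : 0 < q -> rintegrable mu (powexp q).
Proof.
move=> q0.
have cf u : 0 < u -> {for u, continuous (fun u => expR ((q - 1) * ln u) * expR (- u))}.
  move=> u0; apply: continuousM.
    apply: (@continuous_pos_ln_comp R (fun x => expR ((q - 1) * x))) => //.
    exact: (continuous_fcomp (@continuous_scale R (q - 1)) (@continuous_expR R)).
  by apply: continuous_comp; [exact: opp_continuous|exact: continuous_expR].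
have pE : powexp q = (fun u => expR ((q - 1) * ln u) * expR (- u)) \_ `]0, +oo[.
  apply/funext => u; rewrite /powexp patchE; case: ifPn => u0.
    by rewrite mem_set//= in_itv/= u0.
  by rewrite memNset//= in_itv/= andbT; exact/negP.
rewrite pE -restrict_EFin; apply/(integrable_restrict _ _ _ _) => //; rewrite setTI.
apply/integrableP; split.
  apply/measurable_EFinP; apply: open_continuous_measurable_fun; first exact: interval_open.
  by move=> u; rewrite inE/= in_itv/= andbT; exact: cf.
under eq_integral do rewrite /= ger0_norm ?mulr_ge0 ?expR_ge0//.
rewrite ge0_integral_expR_subst//.
have -> : (\int[mu]_w (expR ((q - 1) * ln (expR w)) * expR (- expR w) * expR w)%:E =
    \int[mu]_w (gker q w)%:E)%E.
  by apply: eq_integral => w _; rewrite expRK /gker -!expRD; congr (expR _)%:E; ring.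
by rewrite -EFin_Rintegral ?ltry//; exact: rintegrable_gker.
Qed.

Section Density.
Context (sigma al be w A0 hl : R).
Context (al0 : 0 < al) (be0 : 0 < be) (w0 : 0 < w) (A00 : 0 < A0) (hl0 : 0 < hl).
Context (sa : sigma < al) (sb : sigma < be) (sw : sigma < w).
Local Notation m := (Num.min (Num.min al be) w).
Local Notation f := (snr_density sigma al be w A0 hl).
Local Notation Kd := (Num.sqrt w / (2 * gam al * gam be * gam 2^-1)).
Local Notation lk := (ln (al * be / (A0 * hl))).

Lemma snr_const_gt0 : 0 < Kd.
Proof. by rewrite divr_gt0 ?sqrtr_gt0// !mulr_gt0 ?gam_gt0. Qed.

Lemma foxG_ge0 l : 0 <= foxG al be w l.
Proof. by apply: Rintegral_ge0 => p _; exact: foxG_ker_ge0. Qed.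

Lemma snr_density_ge0 gbar x : 0 < gbar -> 0 < x -> 0 <= f gbar x.
Proof.
move=> g0 x0; rewrite snr_density_foxG// mulr_ge0 ?foxG_ge0//.
by rewrite mulr_ge0 ?invr_ge0 ?(ltW snr_const_gt0)// ltW.
Qed.

Lemma min_gt0 : 0 < m. Proof. by rewrite !lt_min al0 be0 w0. Qed.

Lemma snr_density_le q : 0 < q -> q < m -> exists2 C, 0 < C &
  forall gbar x, 0 < gbar -> 0 < x ->
    f gbar x <= C * expR (- (q / 2 * ln gbar)) * expR ((q / 2 - 1) * ln x).
Proof.
move=> q0; rewrite !lt_min => /andP[/andP[qa qb] qw].
have [C C0 hC] := foxG_le al0 be0 w0 qa qb qw.
exists (Kd * C * expR (q * lk)).
  exact: mulr_gt0 (mulr_gt0 snr_const_gt0 C0) (expR_gt0 _).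
move=> gbar x g0 x0; rewrite snr_density_foxG//.
have -> : x^-1 = expR (- ln x) by rewrite expRN lnK// posrE.
have k0 := snr_const_gt0.
have h := hC (lk + (ln x - ln gbar) / 2).
have kx : 0 <= Kd * expR (- ln x) by rewrite mulr_ge0 ?expR_ge0 ?(ltW k0).
apply: (le_trans (ler_wpM2l kx h)).
rewrite [leLHS](_ : _ = Kd * C * (expR (- ln x) * expR (q * (lk + (ln x - ln gbar) / 2)))); last by ring.
rewrite -[leRHS]mulrA -[leRHS]mulrA; apply: ler_wpM2l; first exact: ltW (mulr_gt0 k0 C0).
rewrite -!expRD ler_expR.
by rewrite le_eqVlt; apply/orP; left; apply/eqP; move: (ln _) (ln _) (ln _) => a b c; field.
Qed.

(** In [foxG_ge] the splitting of l is free; putting all of l on the smallest parameter gives the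
    exponent m. *)
Lemma foxG_ge_min : exists2 c, 0 < c & forall l, l <= 0 -> c * expR (m * l) <= foxG al be w l.
Proof.
have [c c0 hc] := foxG_ge al0 be0 w0; exists c => // l l0.
have [ab|ab] := leP al be; last first.
  have [bw|bw] := leP be w.
    by have := hc 0 l 0 (lexx _) l0 (lexx _); rewrite !(mulr0, addr0, add0r).
  by have := hc 0 0 l (lexx _) (lexx _) l0; rewrite !(mulr0, addr0, add0r).
have [bw|bw] := leP al w.
  by have := hc l 0 0 l0 (lexx _) (lexx _); rewrite !(mulr0, addr0, add0r).
by have := hc 0 0 l (lexx _) (lexx _) l0; rewrite !(mulr0, addr0, add0r).
Qed.

(** The threshold on ln gbar makes the argument l of [foxG] nonpositive for every x <= k, where
    [foxG_ge_min] applies. *)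
Lemma snr_density_ge k : 0 < k -> exists2 c, 0 < c & forall gbar x, 0 < gbar ->
  2 * lk + ln k <= ln gbar -> k / 2 <= x <= k ->
  c * expR (- (m / 2 * ln gbar)) <= f gbar x.
Proof.
move=> k0; have [c c0 hc] := foxG_ge_min.
have kd := snr_const_gt0; have m0 := min_gt0.
(* On [k/2, k], 1/x is at least 1/k and ln x at least ln (k/2). *)
exists (Kd * k^-1 * c * expR (m * (lk + ln (k / 2) / 2))).
  have ki : 0 < k^-1 by rewrite invr_gt0.
  exact: mulr_gt0 (mulr_gt0 (mulr_gt0 kd ki) c0) (expR_gt0 _).
move=> gbar x g0 gk /andP[x1 x2].
have k20 : 0 < k / 2 by rewrite divr_gt0.
have x0 : 0 < x by exact: lt_le_trans x1.
have lx2 : ln x <= ln k by rewrite ler_ln ?posrE.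
have lx1 : ln (k / 2) <= ln x by rewrite ler_ln ?posrE.
rewrite snr_density_foxG//.
set l := lk + (ln x - ln gbar) / 2.
have l0 : l <= 0 by rewrite /l; lra.
apply: (@le_trans _ _ (Kd * k^-1 * (c * expR (m * l)))).
  have ki : 0 < k^-1 by rewrite invr_gt0.
  rewrite [leRHS]mulrA -[leLHS]mulrA; apply: ler_wpM2l.
    exact: ltW (mulr_gt0 (mulr_gt0 kd ki) c0).
  rewrite -expRD ler_expR.
  have : 0 <= m * (ln x - ln (k / 2)) by rewrite mulr_ge0 ?(ltW m0)// subr_ge0.
  rewrite /l; lra.
apply: ler_pM.
- by rewrite mulr_ge0 ?invr_ge0 ?(ltW kd) ?(ltW k0).
- by rewrite mulr_ge0 ?expR_ge0 ?(ltW c0).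
- by rewrite ler_wpM2l ?(ltW kd)// lef_pV2.
- exact: hc.
Qed.
End Density.
End SnrDensityBounds.

(** * Outage probability *)

Section OutageProbability.
Context (R : realType).
Local Notation mu := (@lebesgue_measure R).
Implicit Types a t l : R.

Lemma log2_1D_ge0 (c x : R) : 0 < c -> 0 < x -> 0 <= log2 (1 + c * x).
Proof.
move=> c0 x0; rewrite divr_ge0 ?ln_ge0//; last by rewrite ler1n.
by rewrite lerDl mulr_ge0// ltW.
Qed.

Lemma ln2_gt0 : 0 < ln 2 :> R.
Proof. by rewrite ln_gt0// ltr1n. Qed.

Lemma outage_rate_gt0 : 0 < expR 1 / (2 * pi) :> R.
Proof. by rewrite divr_gt0 ?expR_gt0// mulr_gt0// pi_gt0. Qed.

(** Each term of the sum is nonnegative, hence below 2 Rt by itself, so c x < 1 + c x < 2^(2 Rt). *)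
Lemma outage_event_lt M (Rt : R) (x : M.-tuple R) : outage_event Rt x ->
  forall m, 0 < tnth x m < expR (2 * Rt * ln 2) / (expR 1 / (2 * pi)).
Proof.
move=> [xp xs] m; rewrite xp/=; have c0 := outage_rate_gt0.
set c := expR 1 / (2 * pi) in c0 xs *.
have l2 := ln2_gt0.
have : log2 (1 + c * tnth x m) < 2 * Rt.
  apply: le_lt_trans xs; rewrite (bigD1 m)//= lerDl.
  by apply: sumr_ge0 => i _; apply: log2_1D_ge0.
have y0 : 0 < 1 + c * tnth x m by rewrite addr_gt0// mulr_gt0.
rewrite /log2 ltr_pdivrMr// -[X in is_true X -> _]ltr_expR lnK ?posrE// => h.
rewrite ltr_pdivlMr// mulrC; apply: lt_trans h; rewrite ltrDr//.
Qed.

(** Since log2(1 + u) <= u / ln 2, the assumption on k bounds the sum by Rt, which is strictly below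
    2 Rt. *)
Lemma outage_event_ge M (Rt k : R) (x : M.-tuple R) : 0 < Rt -> 0 < k ->
  M%:R * (expR 1 / (2 * pi) * k) <= Rt * ln 2 ->
  (forall m, k / 2 <= tnth x m <= k) -> outage_event Rt x.
Proof.
move=> Rt0 k0 hk hx; have c0 := outage_rate_gt0; have l2 := ln2_gt0.
have xp m : 0 < tnth x m.
  by case/andP: (hx m) => /(lt_le_trans _) + _; apply; rewrite divr_gt0.
split=> //; rewrite -/(log2 _); set c := expR 1 / (2 * pi) in c0 hk *.
apply: (@le_lt_trans _ _ (\sum_(m < M) (c * k) / ln 2)).
  apply: ler_sum => m _; rewrite ler_wpM2r ?invr_ge0 ?(ltW l2)//.
  have y0 : 0 < 1 + c * tnth x m by rewrite addr_gt0// mulr_gt0.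
  rewrite (@le_trans _ _ (c * tnth x m))//.
    rewrite -ler_expR lnK ?posrE//; exact: expR_ge1Dx.
  by rewrite ler_wpM2l ?(ltW c0)//; case/andP: (hx m).
rewrite sumr_const card_ord -[ltLHS]mulr_natl mulrA ltr_pdivrMr//.
apply: (le_lt_trans hk); rewrite -mulrA ltr_pMl ?mulr_gt0// ltr1n//.
Qed.

Section Outage.
Context (sigma al be w A0 hl Rt : R) (M : nat).
Context (al0 : 0 < al) (be0 : 0 < be) (w0 : 0 < w) (A00 : 0 < A0) (hl0 : 0 < hl).
Context (sa : sigma < al) (sb : sigma < be) (sw : sigma < w) (Rt0 : 0 < Rt).
Local Notation m := (Num.min (Num.min al be) w).
Local Notation P := (outage_prob M sigma al be w A0 hl Rt).

(** The sign of the density is known for x > 0; outside the positive orthant the indicator of the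
    event vanishes. *)
Lemma outage_integrand_ge0 gbar (x : M.-tuple R) : 0 < gbar ->
  0 <= \1_(outage_event Rt) x * \prod_(i < M) snr_density sigma al be w A0 hl gbar (tnth x i).
Proof.
move=> g0; rewrite indicE; have [/set_mem xB|_] := boolP (x \in outage_event Rt); last by rewrite mul0r.
have [xp _] := xB.
by rewrite mul1r; apply: prodr_ge0 => i _; apply: snr_density_ge0.
Qed.

Lemma outage_prob_le q : 0 < q -> q < m -> exists2 C, 0 < C &
  forall gbar, 0 < gbar -> (P gbar <= ((C * expR (- (q / 2 * ln gbar))) ^+ M)%:E)%E.
Proof.
move=> q0 qm; have [C C0 hC] := snr_density_le al0 be0 w0 A00 hl0 sa sb sw q0 qm.
have q20 : 0 < q / 2 by rewrite divr_gt0.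
have ip := rintegrable_powexp q20.
pose K := expR (2 * Rt * ln 2) / (expR 1 / (2 * pi)) : R.
pose I := \int[mu]_x powexp (q / 2) x.
have I0 : 0 <= I.
  by apply: Rintegral_ge0 => x _; rewrite /powexp; case: ifP => // _; rewrite mulr_ge0 ?expR_ge0.
(* exp(K) compensates the factor e^(-x) of [powexp] on ]0, K[, and I + 1 keeps the constant
   positive. *)
exists (C * expR K * (I + 1)).
  by rewrite !mulr_gt0 ?expR_gt0// ltr_wpDl.
move=> gbar g0.
pose B := C * expR (- (q / 2 * ln gbar)) * expR K.
have B0 : 0 < B by rewrite !mulr_gt0 ?expR_gt0.
have iB : rintegrable mu (fun x => B * powexp (q / 2) x) by exact: rintegrableZl.
apply: (@le_trans _ _ (1 * (\int[mu]_x (B * powexp (q / 2) x)) ^+ M)%:E).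
  rewrite -(tuple_integral_prod M 1 iB); apply: le_tuple_integral => x.
    by rewrite lee_fin; exact: outage_integrand_ge0.
  rewrite lee_fin mul1r indicE; have [/set_mem xB|_] := boolP (x \in outage_event Rt); last first.
    rewrite mul0r; apply: prodr_ge0 => i _; rewrite mulr_ge0 ?(ltW B0)//.
    by rewrite /powexp; case: ifP => // _; rewrite mulr_ge0 ?expR_ge0.
  rewrite mul1r; apply: ler_prod => i _.
  have /andP[xi0 xiK] := outage_event_lt xB i.
  rewrite snr_density_ge0//= (le_trans (hC gbar _ g0 xi0))// /powexp xi0 /B.
  rewrite -[leRHS]mulrA ler_wpM2l ?mulr_ge0 ?(ltW C0) ?expR_ge0//.
  rewrite mulrCA ler_peMr ?expR_ge0// -expRD -expR0 ler_expR subr_ge0.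
  exact: ltW.
rewrite mul1r lee_fin (RintegralZl _ measurableT ip) -/I.
apply: lerXn2r; rewrite ?nnegrE ?mulr_ge0 ?(ltW B0) ?expR_ge0 ?(ltW C0) ?addr_ge0//.
rewrite [leRHS](_ : _ = B * (I + 1)); last by rewrite /B; ring.
by rewrite ler_wpM2l ?(ltW B0)// lerDl.
Qed.

Lemma outage_prob_ge : (1 <= M)%N -> exists2 c, 0 < c & exists T, forall gbar, 0 < gbar ->
  T <= ln gbar -> (((c * expR (- (m / 2 * ln gbar))) ^+ M)%:E <= P gbar)%E.
Proof.
move=> M1; have M0 : 0 < M%:R :> R by rewrite ltr0n.
pose k := Rt * ln 2 / (M%:R * (expR 1 / (2 * pi))) : R.
have c0 := outage_rate_gt0; have l2 := ln2_gt0.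
have Mc := mulr_gt0 M0 c0.
have k0 : 0 < k := divr_gt0 (mulr_gt0 Rt0 l2) Mc.
have hk : M%:R * (expR 1 / (2 * pi) * k) <= Rt * ln 2.
  by rewrite /k mulrA mulrCA mulfV ?mulr1// (gt_eqF Mc).
have [c c1 hc] := snr_density_ge al0 be0 w0 A00 hl0 sa sb sw k0.
exists (c * (k / 2)); first by rewrite mulr_gt0// divr_gt0.
(* The threshold T is unified with that of [snr_density_ge], namely 2 ln (al be / (A0 hl)) + ln
   k. *)
eexists => gbar g0 /(hc _ _ g0) h.
pose I : set R := `[k / 2, k]%classic.
have mI : measurable I by exact: measurable_itv.
pose B := c * expR (- (m / 2 * ln gbar)).
have B0 : 0 < B by rewrite mulr_gt0 ?expR_gt0.
have muI : (\int[mu]_x (\1_I x)%:E = (k / 2)%:E)%E.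
  rewrite integral_indic// setIT /= lebesgue_measure_itv/= lte_fin.
  rewrite ltr_pdivrMr// ltr_pMr// ltr1n.
  by rewrite -EFinB; congr EFin; field.
have iI : rintegrable mu (\1_I : R -> R).
  apply/integrableP; split.
    by apply/measurable_EFinP.
  under eq_integral do rewrite /= ger0_norm//.
  by rewrite muI ltry.
have iB : rintegrable mu (fun x => B * \1_I x) by exact: rintegrableZl.
have -> : (c * (k / 2) * expR (- (m / 2 * ln gbar))) ^+ M =
    1 * (\int[mu]_x (B * \1_I x)) ^+ M.
  rewrite mul1r (RintegralZl _ measurableT iI) /Rintegral muI /=; congr (_ ^+ _).
  by rewrite /B; ring.
rewrite -(tuple_integral_prod M 1 iB); apply: le_tuple_integral => x.
  rewrite lee_fin mul1r; apply: prodr_ge0 => i _.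
  by rewrite mulr_ge0 ?(ltW B0).
rewrite lee_fin mul1r.
have [hx|] := boolP [forall i : 'I_M, k / 2 <= tnth x i <= k].
  have xI i : k / 2 <= tnth x i <= k by exact: (forallP hx).
  rewrite [\1_(outage_event Rt) x]indicE mem_set ?mul1r; last exact: outage_event_ge xI.
  apply: ler_prod => i _; rewrite indicE mem_set ?mulr1.
    by rewrite ltW//= h.
  by rewrite /I/= in_itv/=; exact: xI.
(* Outside the cube one indicator vanishes, so the minorant is 0. *)
rewrite negb_forall => /existsP[i hi].
rewrite (bigD1 i)//= [X in B * X]indicE memNset; last first.
  by rewrite /I/= in_itv/=; exact/negP.
by rewrite mulr0 mul0r outage_integrand_ge0.
Qed.
End Outage.

(** After taking logarithms, ln P / ln g lies between - M m / 2 and - M q / 2 up to constants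
    divided by ln g, and q < m is arbitrary. *)
Lemma cvg_outage_ratio (P : R -> R) (M : nat) (m : R) : (1 <= M)%N -> 0 < m ->
  (exists2 c, 0 < c & exists T, forall g, 0 < g -> T <= ln g ->
    (c * expR (- (m / 2 * ln g))) ^+ M <= P g) ->
  (forall q, 0 < q -> q < m -> exists2 C, 0 < C & forall g, 0 < g ->
    P g <= (C * expR (- (q / 2 * ln g))) ^+ M) ->
  ln (P g) / ln g @[g --> +oo] --> - (M%:R / 2 * m).
Proof.
move=> M1 m0 [c c0 [T hc]] hC; have M0 : 0 < M%:R :> R by rewrite ltr0n.
have lnX (a g q : R) : 0 < a ->
    ln ((a * expR (- (q / 2 * ln g))) ^+ M) = M%:R * (ln a - q / 2 * ln g).
  move=> a0; rewrite lnXn ?mulr_gt0 ?expR_gt0// lnM ?posrE ?expR_gt0// expRK.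
  by rewrite [RHS]mulr_natl.
apply/cvgrPdist_le => e e0.
(* Used with q = m - d: the bound m / 2 keeps q positive, and e / M limits the loss M d / 2 in the
   exponent to e / 2. *)
pose d := Num.min (m / 2) (e / M%:R).
have d0 : 0 < d by rewrite lt_min !divr_gt0.
have dm : d < m.
  by apply: (@le_lt_trans _ _ (m / 2)); [rewrite ge_min lexx|rewrite ltr_pdivrMr// ltr_pMr// ltr1n].
have de : M%:R * d <= e.
  by rewrite mulrC -ler_pdivlMr// ge_min lexx orbT.
have [C C0 {}hC] : exists2 C, 0 < C & forall g, 0 < g ->
    P g <= (C * expR (- ((m - d) / 2 * ln g))) ^+ M.
  by apply: hC; rewrite ?subr_gt0// ltrBlDr ltrDl.
(* For ln g >= A the logarithm is positive, the lower bound is available, and the contributions of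
   ln c and ln C are at most e / 2 after division by ln g. *)
pose A := Num.max 1 (Num.max T (2 * M%:R * (`|ln c| + `|ln C|) / e)).
near=> g.
have gA : expR A <= g by near: g; exact: nbhs_pinfty_ge.
have g0 : 0 < g by exact: lt_le_trans (expR_gt0 _) gA.
have lA : A <= ln g by rewrite -ler_expR lnK.
have l1 : 1 <= ln g by rewrite (le_trans _ lA)// le_max lexx.
have lT : T <= ln g by rewrite (le_trans _ lA)// !le_max lexx orbT.
have le_ : 2 * M%:R * (`|ln c| + `|ln C|) <= e * ln g.
  by rewrite mulrC [e * _]mulrC -ler_pdivrMr// mulrC (le_trans _ lA)// !le_max lexx !orbT.
have l0 : 0 < ln g by exact: lt_le_trans l1.
have h1 := hc g g0 lT; have h2 := hC g g0.
have p1 : 0 < (c * expR (- (m / 2 * ln g))) ^+ M by rewrite exprn_gt0// mulr_gt0 ?expR_gt0.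
have Pg : 0 < P g by exact: lt_le_trans h1.
have p2 : 0 < (C * expR (- ((m - d) / 2 * ln g))) ^+ M by rewrite exprn_gt0// mulr_gt0 ?expR_gt0.
have {}h1 : M%:R * (ln c - m / 2 * ln g) <= ln (P g) by rewrite -lnX// ler_ln ?posrE.
have {}h2 : ln (P g) <= M%:R * (ln C - (m - d) / 2 * ln g) by rewrite -lnX// ler_ln ?posrE.
have -> : - (M%:R / 2 * m) - ln (P g) / ln g =
    - ((ln (P g) + M%:R / 2 * m * ln g) / ln g).
  by field; rewrite gt_eqF.
rewrite normrN normrM [`|_^-1|]gtr0_norm ?invr_gt0// ler_pdivrMr// ler_norml.
have hc1 : M%:R * (- `|ln c|) <= M%:R * ln c by rewrite ler_wpM2l ?(ltW M0)// lerNl -normrN ler_norm.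
have hC1 : M%:R * ln C <= M%:R * `|ln C| by rewrite ler_wpM2l ?(ltW M0)// ler_norm.
have hc2 : 0 <= M%:R * `|ln c| by rewrite mulr_ge0 ?(ltW M0).
have hC2 : 0 <= M%:R * `|ln C| by rewrite mulr_ge0 ?(ltW M0).
have hd : M%:R * d * ln g <= e * ln g by rewrite ler_wpM2r ?(ltW l0).
apply/andP; split; nra.
Unshelve. all: by end_near. Qed.
End OutageProbability.

Unset Implicit Arguments.
Set Strict Implicit.

Theorem mainTheorem9 (R : realType) (M : nat)
    (alpha beta omega A0 hl Rt sigma : R)
    (hM : (1 <= M)%N)
    (halpha : 0 < alpha) (hbeta : 0 < beta) (homega : 0 < omega)
    (hA0 : 0 < A0) (hhl : 0 < hl) (hRt : 0 < Rt)
    (hsigma : sigma < Num.min (Num.min alpha beta) omega) :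
  let ratio := fun gbar : R =>
    ln (fine (outage_prob M sigma alpha beta omega A0 hl Rt gbar)) / ln gbar in
  let diversity_order := - lim (ratio gbar @[gbar --> +oo]) in
  [/\ cvg (ratio gbar @[gbar --> +oo]),
      diversity_order
        = M%:R / 2 * Num.min (Num.min alpha beta) omega,
      (Num.min alpha beta < omega ->
        diversity_order = M%:R / 2 * Num.min alpha beta)
    & (omega < Num.min alpha beta ->
        diversity_order = M%:R / 2 * omega)].
Proof.
move=> ratio diversity_order; set m := Num.min (Num.min alpha beta) omega.
have m0 : 0 < m by exact: min_gt0.
have [[sa sb] sw] : (sigma < alpha /\ sigma < beta) /\ sigma < omega.
  by move: hsigma; rewrite !lt_min => /andP[/andP[]].
pose P g := outage_prob M sigma alpha beta omega A0 hl Rt g.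
have P0 g : 0 < g -> (0 <= P g)%E.
  by move=> g0; apply: tuple_integral_ge0 => x; rewrite lee_fin; exact: outage_integrand_ge0.
(* [fine] sends an infinite value to 0, so finiteness comes before any passage to real bounds; q = m
   / 2 is one admissible exponent for the upper bound. *)
have Pfin g : 0 < g -> P g \is a fin_num.
  move=> g0; rewrite ge0_fin_numE ?P0//.
  have [||C _ hC] := @outage_prob_le R sigma alpha beta omega A0 hl Rt M
    halpha hbeta homega hA0 hhl sa sb sw (m / 2).
  - by rewrite divr_gt0.
  - by rewrite ltr_pdivrMr// ltr_pMr// ltr1n.
  by rewrite (le_lt_trans (hC g g0))// ltry.
have h : ratio g @[g --> +oo] --> - (M%:R / 2 * m).
  apply: (@cvg_outage_ratio R (fun g => fine (P g)) M m) => //.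
    have [c c0 [T hc]] := outage_prob_ge halpha hbeta homega hA0 hhl sa sb sw hRt hM.
    by exists c => //; exists T => g g0 Tg; rewrite -lee_fin fineK ?Pfin// hc.
  move=> q q0 qm.
  have [C C0 hC] := @outage_prob_le R sigma alpha beta omega A0 hl Rt M
    halpha hbeta homega hA0 hhl sa sb sw q q0 qm.
  by exists C => // g g0; rewrite -lee_fin fineK ?Pfin// hC.
have dE : diversity_order = M%:R / 2 * m.
  by rewrite /diversity_order (cvg_lim _ h)// opprK.
split => //.
- by apply/cvg_ex; exists (- (M%:R / 2 * m)).
- by move=> lt_o; rewrite dE /m min_l// ltW.
- by move=> lt_o; rewrite dE /m min_r// ltW.
Qed.
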